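(* Let $N\ge 1$, $s>0$, and let $\tau_0,\tau\in\mathbb{C}$ satisfy $|\tau_0-s|\le s$ and $|\tau-s|\le s$. Let $Z^N_{s,\tau_0}$ and $Z^N_{s,\tau}$ be $N\times N$ elliptic random matrices with parameters $(s,\tau_0)$ and $(s,\tau)$ respectively, and let $X_0^N$ be an $N\times N$ random matrix (not necessarily Hermitian) that is independent of $Z^N_{s,\tau_0}$ and of $Z^N_{s,\tau}$. Define $$D^N(z,s,\tau)=\mathbb{E}\{|\det(zI-(X_0^N+Z_{s,\tau}^N))|^2\},\qquad z\in\mathbb{C}.$$ Then for all $z\in\mathbb{C}$, $$D^N(z,s,\tau)=\mathbb{E}\left\{\left|\exp\left(\frac{\tau-\tau_0}{2N}\frac{\partial^2}{\partial z^2}\right)\det(zI-(X_0^N+Z^N_{s,\tau_0}))\right|^2\right\}.$$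
   Context: Elliptic random matrices: let $X^N,Y^N$ be independent $N\times N$ GUE matrices, normalized so that $\mathbb{E}\{\frac1N\operatorname{Trace}((X^N)^2)\}=1$. For real $\theta$ and real $a,b$ not both zero, put $Z^N=e^{i\theta}(aX^N+ibY^N)$. Its parameters are $$s=\mathbb{E}\{\tfrac1N\operatorname{Trace}((Z^N)^*Z^N)\}>0,\qquad \tau=\mathbb{E}\{\tfrac1N\operatorname{Trace}((Z^N)^*Z^N)\}-\mathbb{E}\{\tfrac1N\operatorname{Trace}((Z^N)^2)\}\in\mathbb{C}.$$ The parameters $s$ and $\tau$ determine the distribution of $Z^N$ and always satisfy $|\tau-s|\le s$; $Z^N_{s,\tau}$ denotes such a matrix with parameters $(s,\tau)$. Standing assumption: all expected $*$-moments of $X_0^N$ (expectations of normalized traces of words in $X_0^N$ and its adjoint) are well defined and finite. Heat operator: for a polynomial $p$ in $z$ and $\sigma\in\mathbb{C}$, $\exp\left(\frac{\sigma}{2N}\frac{\partial^2}{\partial z^2}\right)p(z)=\sum_{k\ge0}\frac1{k!}\left(\frac{\sigma}{2N}\right)^k\left(\frac{d^2}{dz^2}\right)^kp(z)$ (a terminating sum), with $d/dz$ the complex derivative. *)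

(* Defs.v *)
From HB Require Import structures.
From mathcomp Require Import all_boot all_order all_algebra.
From mathcomp Require Import complex.
From mathcomp Require Import all_classical all_reals all_analysis.
Set Implicit Arguments.
Unset Strict Implicit.
Unset Printing Implicit Defensive.
Import Order.TTheory GRing.Theory Num.Theory.

#[global] Open Scope classical_set_scope.
#[global] Open Scope ring_scope.
#[global] Open Scope complex_scope.

(* The normalized trace (1/N) Trace. *)
Definition ntr (F : fieldType) (N : nat) (A : 'M[F]_N) : F :=
  N%:R^-1 * \tr A.

Definition adjmx (R : realType) (N : nat) (A : 'M[R[i]]_N) : 'M[R[i]]_N :=
  (map_mx conjc A)^T.

(* exp ((sigma / (2 N)) d^2/dz^2) p.  The exponential series is cut at
   [size p] = deg p + 1 terms; the k-th term already vanishes for 2 k > deg p. *)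
Definition heat (F : fieldType) (N : nat) (sigma : F) (p : {poly F}) :
    {poly F} :=
  \sum_(k < size p)
    ((k`!)%:R^-1 * (sigma / (2 * N%:R)) ^+ k) *:
      iter k (fun q : {poly F} => q^`(2)) p.

Section RandomMatrices.
Context (d : measure_display) (T : measurableType d) (R : realType).
Variable P : probability T R.

(* [fine] sends infinite values to 0, so [cexpect f] is meaningful only when
   the real and imaginary parts of f are integrable. *)
Definition cexpect (f : T -> R[i]) : R[i] :=
  fine 'E_P[fun w => complex.Re (f w)] +i* fine 'E_P[fun w => complex.Im (f w)].

Definition cintegrable (f : T -> R[i]) : Prop :=
  P.-integrable setT (fun w => (complex.Re (f w))%:E) /\
  P.-integrable setT (fun w => (complex.Im (f w))%:E).

Definition random_mx (N : nat) (X : T -> 'M[R[i]]_N) : Prop :=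
  forall i j, measurable_fun setT (fun w => complex.Re (X w i j)) /\
              measurable_fun setT (fun w => complex.Im (X w i j)).

(* Borel sigma-algebra of the real vector space of complex N x N matrices,
   generated by the real and imaginary parts of the entries. *)
Definition mx_borel (N : nat) : set (set 'M[R[i]]_N) :=
  <<s [set C | exists (i j : 'I_N) (B : set R), measurable B /\
        (C = [set A : 'M[R[i]]_N | B (complex.Re (A i j))] \/
         C = [set A : 'M[R[i]]_N | B (complex.Im (A i j))])] >>.

Definition indep_mx (N : nat) (X Y : T -> 'M[R[i]]_N) : Prop :=
  forall A B : set 'M[R[i]]_N, @mx_borel N A -> @mx_borel N B ->
    P (X @^-1` A `&` Y @^-1` B) = (P (X @^-1` A) * P (Y @^-1` B))%E.

(* Mutual independence of a finite family of real random variables; smaller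
   subfamilies are covered by taking some of the B k to be [setT]. *)
Definition mutually_indep (I : finType) (f : I -> T -> R) : Prop :=
  forall B : I -> set R, (forall k, measurable (B k)) ->
    P (\bigcap_(k in setT) (f k @^-1` B k)) = (\prod_k P (f k @^-1` B k))%E.

(* The N^2 real coordinates of a Hermitian matrix, all read off from its upper
   triangle: position (i, j) gives Re X_ij if i <= j, and Im X_ji if j < i. *)
Definition herm_coord (N : nat) (X : T -> 'M[R[i]]_N) (k : 'I_N * 'I_N) :
    T -> R :=
  fun w => if (k.1 <= k.2)%N then complex.Re (X w k.1 k.2)
           else complex.Im (X w k.2 k.1).

(* Hermitian, with independent centred Gaussian coordinates of variance 1/N on
   the diagonal and 1/(2N) for the real and imaginary parts off the diagonal,
   so that E (1/N) Trace (X^2) = (1/N) \sum_(i, j) E |X_ij|^2 = 1.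
   The second argument of [normal_prob] is the standard deviation. *)
Definition GUE (N : nat) (X : T -> 'M[R[i]]_N) : Prop :=
  [/\ random_mx X,
      forall w, adjmx (X w) = X w,
      mutually_indep (herm_coord X) &
      forall (k : 'I_N * 'I_N) (B : set R), measurable B ->
        P (herm_coord X k @^-1` B) =
        normal_prob 0
          (Num.sqrt (if k.1 == k.2 then N%:R^-1 else (2 * N%:R)^-1)) B].

Definition elliptic (N : nat) (s : R) (tau : R[i]) (Z : T -> 'M[R[i]]_N) :
    Prop :=
  exists (theta a b : R) (X Y : T -> 'M[R[i]]_N),
    [/\ [/\ ~ (a = 0 /\ b = 0), GUE X, GUE Y & indep_mx X Y],
        forall w, Z w = (cos theta +i* sin theta) *:
                          (a%:C *: X w + (0 +i* b) *: Y w),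
        s%:C = cexpect (fun w => ntr (adjmx (Z w) *m Z w)) &
        tau = cexpect (fun w => ntr (adjmx (Z w) *m Z w))
              - cexpect (fun w => ntr (Z w *m Z w))].

(* A word is a sequence of booleans, [true] standing for the adjoint. *)
Definition finite_star_moments (N : nat) (X : T -> 'M[R[i]]_N) : Prop :=
  forall u : seq bool,
    cintegrable (fun w => ntr
      (foldr (fun (b : bool) (A : 'M[R[i]]_N) =>
                (if b then adjmx (X w) else X w) *m A) 1%:M u)).

End RandomMatrices.

(* Main.v *)
Require Import Defs.
From HB Require Import structures.
From mathcomp Require Import all_boot all_order all_fingroup all_algebra.
From mathcomp Require Import complex.
From mathcomp Require Import all_classical all_reals all_analysis.
From mathcomp Require Import measurable_realfun ring lra.
(** Both sides are integrals of nonnegative functions, so independence and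
    Tonelli's theorem reduce the identity to the case where $X_0$ is a fixed
    matrix $A$ ([integral_indep_mx], [integral_elliptic_heat]).  An elliptic
    matrix is an explicit linear function [ell_mx] of the $2N^2$ independent
    Gaussian coordinates of its two GUE matrices, whose joint law is always
    the same; the parameters $(s,\tau)$ only enter through the coefficients
    of this function ([elliptic_param]).

    For $i<j$ the pair $u=Z_{ij}$, $v=Z_{ji}$ is independent of the other
    entries, and a determinant is affine in each entry, hence of the form
    $\alpha+\beta u+\gamma v+\delta uv$.  Gaussian integration gives
    $$E|\alpha+\beta u+\gamma v+\delta uv|^2
      =|\alpha+c\delta|^2+r|\beta|^2+r|\gamma|^2+r^2|\delta|^2,
      \qquad r=s/N,\quad c=(s-\tau)/N,$$
    where $c=E(uv)$ is the only place in which $\tau$ occurs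
    ([same_int_offdiag_block]).  Replacing $\tau$ by $\tau_0$ in this one pair
    is therefore compensated exactly by replacing $\alpha$ with
    $\alpha+\kappa\delta$, where $\kappa=(\tau_0-\tau)/N$, that is, by
    applying $1+\kappa\,\partial_{ij}\partial_{ji}$ to the determinant.  The
    result is again affine in each entry, so the pairs can be treated one
    after the other, through matrices in which some pairs have parameter
    $\tau$ and the others $\tau_0$ ([same_int_block], [same_int_all_blocks]);
    the law of a diagonal entry enters only through $r$.

    It remains to see that $\prod_{i<j}(1+\kappa\,\partial_{ij}\partial_{ji})$
    acts on $\det(z-M)$ as the heat operator.  The factors commute and have
    square zero on functions affine in each entry, so the product is
    $\exp(\kappa\sum_{i<j}\partial_{ij}\partial_{ji})$
    ([prod_one_plus_nilpotent]).  Exchanging two rows shows that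
    $\partial_{ij}\partial_{ji}\det(z-M)=-\partial_{ii}\partial_{jj}\det(z-M)$
    ([mixdiff_shifted_det]), whence the exponent acts as
    $-\frac\kappa2(\sum_i\partial_{ii})^2$; finally $\sum_i\partial_{ii}$
    acts as $-d/dz$, because the determinant depends on $z$ through $z-M$
    ([derivn_char_poly]).  With $-\kappa/2=(\tau-\tau_0)/(2N)$ this is the heat
    operator of the theorem. *)

Set Implicit Arguments.
Unset Strict Implicit.
Unset Printing Implicit Defensive.
Import Order.TTheory GRing.Theory Num.Theory.
Import numFieldNormedType.Exports.
Local Open Scope classical_set_scope.
Local Open Scope ring_scope.
Local Open Scope complex_scope.

(** * Moments of a centred normal law *)

Section GaussianMoments.
Context (R : realType) (sigma : R) (sigma_gt0 : 0 < sigma).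
Local Notation mu := (@lebesgue_measure R).
Local Notation g := (normal_pdf 0 sigma).
Local Notation gam := (normal_prob 0 sigma).

(** The normal law is defined as a set function with density [g]; its
    Radon-Nikodym derivative agrees with [g] almost everywhere, which turns
    integrals against the law into Lebesgue integrals. *)
Lemma ge0_integral_normal_prob (f : R -> \bar R) :
  measurable_fun setT f -> (forall x, (0 <= f x)%E) ->
  (\int[gam]_x f x = \int[mu]_x (f x * (g x)%:E))%E.
Proof.
move=> mf f0.
have dom := normal_prob_dominates (0:R) sigma.
rewrite -(Radon_Nikodym_SigmaFinite.change_of_variables dom)//=.
apply: ae_eq_integral => //.
- apply: emeasurable_funM => //.
  exact: measurable_int (Radon_Nikodym_SigmaFinite.f_integrable _).
- apply: emeasurable_funM => //; apply/measurable_EFinP.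
  exact: measurable_normal_pdf.
- apply: ae_eqe_mul2l.
  apply: integral_ae_eq => //=.
  + exact: Radon_Nikodym_SigmaFinite.f_integrable.
  + by apply/measurable_EFinP; exact: measurable_normal_pdf.
  + move=> E _ mE.
    by rewrite -Radon_Nikodym_SigmaFinite.f_integral.
Qed.

Let k : R := (2 * sigma ^+ 2)^-1.
Let peak : R := normal_peak sigma.

Lemma normal_pdf0E x : g x = peak * expR (- (k * x ^+ 2)).
Proof.
rewrite /normal_pdf gt_eqF// /normal_fun subr0 /k [2 * _]mulr_natl.
by congr (_ * expR _); rewrite mulNr mulrC.
Qed.

(** A polynomial factor is absorbed by doubling the standard deviation.  This
    single bound provides the integrability of the moments up to order four and
    the decay at infinity needed to integrate by parts. *)
Lemma normal_moment_bound : {C : R | 0 <= C &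
  forall x, (1 + x ^+ 4) * g x <= C * normal_pdf 0 (2 * sigma) x}.
Proof.
(* The exponents of the two densities differ by 3 x^2 / (8 sigma^2) = 2 y, where
   y = c x^2, and both 1 and y^2 are at most exp (2 y). *)
pose c : R := 3 / (16 * sigma ^+ 2).
have s2 : 0 < sigma ^+ 2 by rewrite exprn_gt0.
have c0 : 0 < c by rewrite divr_gt0// mulr_gt0.
have p2 : 0 < normal_peak (2 * sigma) by rewrite normal_peak_gt0// mulf_neq0// gt_eqF.
have p1 : 0 <= peak by exact: normal_peak_ge0.
exists (peak * (1 + c ^- 2) / normal_peak (2 * sigma)).
  by rewrite mulr_ge0 ?invr_ge0 ?(ltW p2)// mulr_ge0// addr_ge0// invr_ge0 exprn_ge0// ltW.
move=> x; rewrite normal_pdf0E /normal_pdf gt_eqF ?mulr_gt0//.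
rewrite [leRHS]mulrA divfK ?gt_eqF//.
rewrite /normal_fun subr0 [leLHS]mulrCA -mulrA ler_wpM2l//.
have ->: - x ^+ 2 / ((2 * sigma) ^+ 2 *+ 2) = c * x ^+ 2 * 2 - k * x ^+ 2.
  by rewrite /c /k -mulr_natr; field; rewrite gt_eqF.
rewrite expRD mulrA ler_wpM2r ?expR_ge0//.
have y0 : 0 <= c * x ^+ 2 by rewrite mulr_ge0 ?sqr_ge0// ltW.
have h1 : 1 <= expR (c * x ^+ 2 * 2) by rewrite -expR0 ler_expR mulr_ge0.
have h2 : (c * x ^+ 2) ^+ 2 <= expR (c * x ^+ 2 * 2).
  rewrite (mulr_natr (c * x ^+ 2) 2) -mulr_natr expRM_natr lerXn2r ?nnegrE ?expR_ge0//.
  by rewrite (le_trans _ (expR_ge1Dx _))// lerDr.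
rewrite mulrDl mul1r lerD//.
rewrite ler_pdivlMl ?exprn_gt0// (le_trans _ h2)//.
by rewrite [leRHS]exprMn -exprM.
Qed.

Lemma integrable_moment n : (n <= 4)%N ->
  mu.-integrable setT (fun x : R => (x ^+ n * g x)%:E).
Proof.
move=> n4; have [C C0 hC] := normal_moment_bound.
apply: (@le_integrable _ _ _ mu setT _ _
    (fun x : R => (C%:E * (normal_pdf 0 (2 * sigma) x)%:E)%E)) => //.
- apply/measurable_EFinP/measurable_funM; last exact: measurable_normal_pdf.
  exact: measurable_funX.
- move=> x _; rewrite -EFinM !abse_EFin lee_fin normrM (ger0_norm (normal_pdf_ge0 _ _ _)).
  rewrite ?normrM ?(ger0_norm C0) ?(ger0_norm (normal_pdf_ge0 _ _ _)).
  apply: le_trans (hC x); rewrite ler_wpM2r ?normal_pdf_ge0// normrX.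
  have [x1|x1] := leP `|x| 1.
    rewrite (@le_trans _ _ 1) ?exprn_ile1 ?lerDl ?exprn_even_ge0//.
  rewrite (@le_trans _ _ (`|x| ^+ 4))//; first by rewrite ler_eXn2l//.
  by rewrite -normrX ger0_norm ?exprn_even_ge0// lerDr.
- apply: integrableZl => //; exact: integrable_normal_pdf.
Qed.

Lemma is_derive_pdf (x : R) :
  is_derive x 1 g (- (sigma ^- 2 * x) * g x).
Proof.
have -> : g = (fun x => peak * expR (- (k * x ^+ 2))) by apply/funext => y; exact: normal_pdf0E.
apply: is_derive_eq.
rewrite /GRing.scale /= /k; field; rewrite gt_eqF//.
Qed.

Lemma is_derive_moment n (x : R) :
  is_derive x 1 (fun y : R => y ^+ n * g y)
    ((n%:R * x ^+ n.-1 - sigma ^- 2 * x ^+ n.+1) * g x).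
Proof.
have := is_derive_pdf x => ?.
case: n => [|n].
  rewrite (_ : (fun y => _) = g); last by apply/funext => y; rewrite expr0 mul1r.
  by rewrite mul0r sub0r expr1.
rewrite (_ : (fun y => _) = id ^+ n.+1 * g); last first.
  by apply/funext => y; rewrite !fctE; congr (_ * _); elim: (n.+1) => [|m IH];
    rewrite ?expr0// exprS IH exprS.
apply: (is_derive_eq (is_deriveM (is_deriveX n.+1 (is_derive_id x 1)) (is_derive_pdf x))).
have -> : (id ^+ n.+1 : R -> R) x = x ^+ n.+1.
  by elim: (n.+1) => [|m IH]; rewrite ?expr0// exprS [in RHS]exprS -IH.
have sc (a b : R) : a *: b = a * b by [].
rewrite !sc mulr1 /= !exprS; ring.
Qed.

(** The fundamental theorem of calculus speaks of compact intervals; this limit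
    extends it to the line. *)
Lemma cvg_integral_symitv (f : R -> R) : mu.-integrable setT (EFin \o f) ->
  (\int[mu]_(x in `[(- n.+1%:R)%R, n.+1%:R%R]) (f x)%:E)%E @[n --> \oo] -->
  (\int[mu]_x (f x)%:E)%E.
Proof.
move=> fi.
have mf := measurable_int _ fi.
have := @dominated_convergence _ _ R mu setT measurableT
  (fun n => (EFin \o f) \_ `[- n.+1%:R, n.+1%:R]) (EFin \o f) (fun x => `|(f x)%:E|%E).
case.
- move=> n; apply/(measurable_restrictT _ _).1 => //.
  exact: measurable_funTS.
- exact: mf.
- apply/aeW => x _ /=; apply: cvg_near_cst; near=> n.
  rewrite patchE ifT// inE/= in_itv/= -ler_norml.
  near: n.
  exists (Num.truncn `|x|).+1 => // n /= xn.
  rewrite (le_trans (ltW (truncnS_gt _)))// ler_nat.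
  by rewrite (leq_trans xn).
- exact: integrable_abse.
- apply/aeW => x n _ /=; rewrite patchE; case: ifP => // _.
  by rewrite abse0.
move=> _ _; apply: cvg_trans; apply: near_eq_cvg; near=> n.
by rewrite /= -integral_mkcond.
Unshelve. all: end_near.
Qed.

Lemma pdf_moment_decay n : (n <= 3)%N -> {C : R | 0 <= C & forall x, 0 < x ->
   `|x ^+ n * g x| <= C / x /\ `|(- x) ^+ n * g (- x)| <= C / x}.
Proof.
move=> n3.
have [C C0 hC] := normal_moment_bound.
exists (C * normal_peak (2 * sigma)); first by rewrite mulr_ge0 ?normal_peak_ge0.
have gN x : g (- x) = g x by rewrite !normal_pdf0E sqrrN.
suff H x : 0 < x -> `|x ^+ n * g x| <= C * normal_peak (2 * sigma) / x.
  by move=> x x0; rewrite gN !normrM !normrX normrN -normrX -normrM; split; exact: H.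
move=> x0; rewrite ler_pdivlMr// normrM (ger0_norm (normal_pdf_ge0 _ _ _)) mulrAC.
rewrite -{2}(gtr0_norm x0) -normrM -exprSr normrX.
apply: (@le_trans _ _ (C * normal_pdf 0 (2 * sigma) x)); last first.
  by rewrite ler_wpM2l// normal_pdf_ub// mulf_neq0// gt_eqF.
apply: le_trans (hC x); rewrite ler_wpM2r ?normal_pdf_ge0//.
have [x1|x1] := leP `|x| 1.
  rewrite (@le_trans _ _ 1) ?exprn_ile1 ?lerDl ?exprn_even_ge0//.
rewrite (@le_trans _ _ (`|x| ^+ 4))//; first by rewrite ler_eXn2l.
by rewrite -normrX ger0_norm ?exprn_even_ge0// lerDr.
Qed.

(** The integrand is the derivative of $x^n g(x)$, which vanishes at both ends of
    the line. *)
Lemma integral_derive_moment n : (n <= 3)%N ->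
  (\int[mu]_x ((n%:R * x ^+ n.-1 - sigma ^- 2 * x ^+ n.+1) * g x)%:E = 0)%E.
Proof.
move=> n3; set f := fun x : R => (n%:R * x ^+ n.-1 - sigma ^- 2 * x ^+ n.+1) * g x.
have fE : EFin \o f = (fun x : R =>
    (n%:R%:E * (x ^+ n.-1 * g x)%:E - (sigma ^- 2)%:E * (x ^+ n.+1 * g x)%:E)%E).
  by apply/funext => x; rewrite /f /= -!EFinM -EFinB mulrBl !mulrA.
have fi : mu.-integrable setT (EFin \o f).
  rewrite fE; apply: integrableB => //; apply: integrableZl => //; apply: integrable_moment => //.
  by rewrite (leq_trans (leq_pred _))// (leq_trans n3).
have fc := cvg_integral_symitv fi.
have [C C0 hC] := pdf_moment_decay n3.
pose F := fun y : R => y ^+ n * g y.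
have cF : continuous F.
  move=> x; apply: differentiable_continuous; apply/derivable1_diffP.
  by have [] := is_derive_moment n x.
have cf : continuous f.
  move=> x; apply: cvgM; last by apply: continuous_normal_pdf; rewrite gt_eqF.
  apply: cvgB; apply: cvgM; try exact: cvg_cst; exact: exprn_continuous.
have E m : (\int[mu]_(x in `[(- m.+1%:R)%R, m.+1%:R%R]) (f x)%:E)%E =
    (F m.+1%:R - F (- m.+1%:R))%:E.
  rewrite (@continuous_FTC2 _ _ F)//.
  - by rewrite -subr_gt0 opprK addr_gt0.
  - exact: continuous_subspaceT.
  - split; last 2 first.
    + by apply: cvg_at_right_filter; exact: cF.
    + by apply: cvg_at_left_filter; exact: cF.
    by move=> x _; have [] := is_derive_moment n x.
  - by move=> x _; rewrite derive1E; have [] := is_derive_moment n x.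
suff f0 : ((F m.+1%:R - F (- m.+1%:R))%:E @[m --> \oo] --> 0%E)%classic.
  by move: fc; under eq_fun do rewrite E; move=> fc; exact: (cvg_unique _ fc f0).
apply: cvg_EFin; first exact: nearW.
apply/cvgr0Pnorm_le => e e0; near=> m.
have m0 : 0 < m.+1%:R :> R by rewrite ltr0n.
have [h1 h2] := hC _ m0.
rewrite /= (le_trans (ler_normB _ _))// (le_trans (lerD h1 h2))//.
rewrite -mulrDl ler_pdivrMr// mulrC -ler_pdivrMr//.
near: m.
exists (Num.truncn ((C + C) / e)).+1 => // m /= xn.
rewrite (le_trans (ltW (truncnS_gt _)))// ler_nat.
by rewrite (leq_trans xn).
Unshelve. all: end_near.
Qed.

Local Notation M n := (\int[mu]_x (x ^+ n * g x)%:E)%E.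

Lemma normal_moment_rec n : (n <= 3)%N -> M n.+1 = ((sigma ^+ 2 * n%:R)%:E * M n.-1)%E.
Proof.
move=> n3; have := integral_derive_moment n3.
have n14 : (n.-1 <= 4)%N by rewrite (leq_trans (leq_pred _))// (leq_trans n3).
have s2 : sigma ^+ 2 != 0 by rewrite expf_neq0// gt_eqF.
under eq_integral do rewrite mulrBl -!mulrA EFinB !EFinM.
rewrite integralB//=; last 2 first.
- by apply: integrableZl => //; exact: integrable_moment.
- by apply: integrableZl => //; exact: integrable_moment.
rewrite !integralZl//; [|exact: integrable_moment..].
have /fineK <- := integrable_fin_num measurableT (@integrable_moment n.+1 n3).
have /fineK <- := integrable_fin_num measurableT (@integrable_moment n.-1 n14).
rewrite -!EFinM -EFinB => -[] /eqP; rewrite subr_eq0 => /eqP h.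
by congr EFin; rewrite -mulrA h mulVKf.
Qed.

(** The integrand is required to be nonnegative so that the integral against the
    law can be rewritten with the density without checking integrability. *)
Lemma integral_normal_quartic q0 q1 q2 q3 q4 :
  (forall t : R, 0 <= q0 + q1 * t + q2 * t ^+ 2 + q3 * t ^+ 3 + q4 * t ^+ 4) ->
  (\int[gam]_t (q0 + q1 * t + q2 * t ^+ 2 + q3 * t ^+ 3 + q4 * t ^+ 4)%:E =
  (q0 + sigma ^+ 2 * q2 + 3 * sigma ^+ 4 * q4)%:E)%E.
Proof.
move=> Q0.
rewrite ge0_integral_normal_prob; last 2 first.
- apply/measurable_EFinP.
  by repeat apply: measurable_funD => //; apply: measurable_funM => //; exact: measurable_funX.
- by move=> x; rewrite lee_fin.
have m0 : M 0 = 1%E by under eq_integral do rewrite expr0 mul1r; exact: integral_normal_pdf.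
have m1 : M 1 = 0%E by rewrite normal_moment_rec// mulr0 mul0e.
have m2 : M 2 = (sigma ^+ 2)%:E by rewrite normal_moment_rec// m0 mulr1 mule1.
have m3 : M 3 = 0%E by rewrite normal_moment_rec// m1 mule0.
have m4 : M 4 = (3 * sigma ^+ 4)%:E.
  by rewrite normal_moment_rec// m2 -EFinM; congr EFin; ring.
under eq_integral.
  move=> x _.
  rewrite -EFinM (_ : _ * g x = q0 * (x ^+ 0 * g x) + q1 * (x ^+ 1 * g x)
    + q2 * (x ^+ 2 * g x) + q3 * (x ^+ 3 * g x) + q4 * (x ^+ 4 * g x)); last first.
    by rewrite expr0 expr1; ring.
  rewrite !EFinD (EFinM q0) (EFinM q1) (EFinM q2) (EFinM q3) (EFinM q4); over.
have I q n : (n <= 4)%N -> mu.-integrable setT (fun x : R => (q%:E * (x ^+ n * g x)%:E)%E).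
  by move=> n4; apply: integrableZl => //; exact: integrable_moment.
have II q n : (n <= 4)%N -> (\int[mu]_x (q%:E * (x ^+ n * g x)%:E) = q%:E * M n)%E.
  by move=> n4; rewrite -integralZl//; exact: integrable_moment.
rewrite !integralD//=; try by repeat first [exact: I | apply: integrableD => //].
rewrite !II// m0 m1 m2 m3 m4 !mule0 -!EFinM !adde0 -!EFinD mulr1.
by congr EFin; ring.
Qed.

End GaussianMoments.

(** * Squared moduli and their Gaussian averages *)

Section SquaredModulus.
Context {R : realType}.
Implicit Types z : R[i].

Definition sqn z : R := complex.Re z ^+ 2 + complex.Im z ^+ 2.

Lemma sqn_ge0 z : 0 <= sqn z.
Proof. by rewrite addr_ge0 ?sqr_ge0. Qed.

Lemma normc_sqr z : Normc.normc z ^+ 2 = sqn z.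
Proof. by case: z => a b; rewrite /= sqr_sqrtr// addr_ge0 ?sqr_ge0. Qed.

Lemma sqnM z1 z2 : sqn (z1 * z2) = sqn z1 * sqn z2.
Proof. by case: z1 z2 => a b [c e]; rewrite /sqn /=; ring. Qed.

Lemma sqn_real (a : R) : sqn a%:C = a ^+ 2.
Proof. by rewrite /sqn /= expr0n addr0. Qed.

Lemma sqn_im (a : R) : sqn (0 +i* a) = a ^+ 2.
Proof. by rewrite /sqn /= expr0n add0r. Qed.

Lemma sqn0 : sqn (0 : R[i]) = 0.
Proof. by rewrite /sqn /= expr0n addr0. Qed.

Lemma sqnN z : sqn (- z) = sqn z.
Proof. by case: z => a b; rewrite /sqn /= !sqrrN. Qed.

(** The Hermite polynomials $1$, $t$ and $t^2-\sigma^2$ are orthogonal for the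
    normal law, with squared norms $1$, $\sigma^2$ and $2\sigma^4$; the constant
    $\sigma^2h_2$ comes from expanding $h_2t^2$ in this basis. *)
Lemma integral_normal_sqn (sigma : R) (h0 h1 h2 : R[i]) : 0 < sigma ->
  (\int[normal_prob 0 sigma]_t (sqn (h0 + h1 * t%:C + h2 * (t ^+ 2)%:C))%:E =
  (sqn (h0 + (sigma ^+ 2)%:C * h2) + sigma ^+ 2 * sqn h1
    + 2 * sigma ^+ 4 * sqn h2)%:E)%E.
Proof.
move=> s0; case: h0 => a0 b0; case: h1 => a1 b1; case: h2 => a2 b2.
pose q0 := a0 ^+ 2 + b0 ^+ 2.
pose q1 := 2 * (a0 * a1 + b0 * b1).
pose q2 := a1 ^+ 2 + b1 ^+ 2 + 2 * (a0 * a2 + b0 * b2).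
pose q3 := 2 * (a1 * a2 + b1 * b2).
pose q4 := a2 ^+ 2 + b2 ^+ 2.
have E t : sqn (a0 +i* b0 + (a1 +i* b1) * t%:C + (a2 +i* b2) * (t ^+ 2)%:C)
   = q0 + q1 * t + q2 * t ^+ 2 + q3 * t ^+ 3 + q4 * t ^+ 4.
  by rewrite /sqn; simpc => /=; rewrite /q0 /q1 /q2 /q3 /q4; ring.
under eq_integral do rewrite E.
rewrite integral_normal_quartic//; last by move=> t; rewrite -E sqn_ge0.
congr EFin; rewrite /sqn; simpc => /=; rewrite /q0 /q1 /q2 /q3 /q4; ring.
Qed.

End SquaredModulus.

(** * Complex-valued measurable functions *)

Section ComplexMeasurable.
Context d (T : measurableType d) (R : realType).
Implicit Types f g : T -> R[i].

Definition cmeas f := measurable_fun setT (fun w => complex.Re (f w)) /\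
                      measurable_fun setT (fun w => complex.Im (f w)).

Lemma cmeas_ext f g : f =1 g -> cmeas f -> cmeas g.
Proof. by move=> fg; have -> : g = f by apply/funext => x; rewrite fg. Qed.

Lemma cmeas_cst c : cmeas (fun=> c).
Proof. by split; exact: measurable_cst. Qed.

Lemma cmeas_real (f : T -> R) : measurable_fun setT f -> cmeas (fun w => (f w)%:C).
Proof. by move=> mf; split => //=; exact: measurable_cst. Qed.

Lemma cmeasD f g : cmeas f -> cmeas g -> cmeas (fun w => f w + g w).
Proof.
move=> [f1 f2] [g1 g2]; split.
  rewrite (_ : (fun w => _) = (fun w => complex.Re (f w) + complex.Re (g w))).
    exact: measurable_funD.
  by apply/funext => w; case: (f w) (g w) => ? ? [].
rewrite (_ : (fun w => _) = (fun w => complex.Im (f w) + complex.Im (g w))).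
  exact: measurable_funD.
by apply/funext => w; case: (f w) (g w) => ? ? [].
Qed.

Lemma cmeasM f g : cmeas f -> cmeas g -> cmeas (fun w => f w * g w).
Proof.
move=> [f1 f2] [g1 g2]; split.
  rewrite (_ : (fun w => _) = (fun w => complex.Re (f w) * complex.Re (g w) -
     complex.Im (f w) * complex.Im (g w))).
    by apply: measurable_funB; exact: measurable_funM.
  by apply/funext => w; case: (f w) (g w) => ? ? [].
rewrite (_ : (fun w => _) = (fun w => complex.Re (f w) * complex.Im (g w) +
     complex.Im (f w) * complex.Re (g w))).
  by apply: measurable_funD; exact: measurable_funM.
by apply/funext => w; case: (f w) (g w) => ? ? [].
Qed.

Lemma cmeasN f : cmeas f -> cmeas (fun w => - f w).
Proof.
move=> mf; under eq_fun do rewrite -mulN1r.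
by apply: cmeasM => //; exact: cmeas_cst.
Qed.

Lemma cmeasB f g : cmeas f -> cmeas g -> cmeas (fun w => f w - g w).
Proof. by move=> mf mg; apply: cmeasD => //; exact: cmeasN. Qed.

Lemma cmeas_sum (I : Type) (s : seq I) (p : pred I) (F : I -> T -> R[i]) :
  (forall i, cmeas (F i)) -> cmeas (fun w => \sum_(i <- s | p i) F i w).
Proof.
move=> mF; elim: s => [|i s IH].
  by under eq_fun do rewrite big_nil; exact: cmeas_cst.
under eq_fun do rewrite big_cons.
by case: (p i) => //; exact: cmeasD.
Qed.

Lemma cmeas_prod (I : Type) (s : seq I) (p : pred I) (F : I -> T -> R[i]) :
  (forall i, cmeas (F i)) -> cmeas (fun w => \prod_(i <- s | p i) F i w).
Proof.
move=> mF; elim: s => [|i s IH].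
  by under eq_fun do rewrite big_nil; exact: cmeas_cst.
under eq_fun do rewrite big_cons.
by case: (p i) => //; exact: cmeasM.
Qed.

Lemma measurable_sqn f : cmeas f -> measurable_fun setT (fun w => (sqn (f w))%:E).
Proof.
move=> [f1 f2]; apply/measurable_EFinP.
by apply: measurable_funD; exact: measurable_funX.
Qed.

End ComplexMeasurable.

Ltac solve_cmeas := repeat lazymatch goal with
  | |- cmeas (fun=> ?c) => exact: (cmeas_cst _ c)
  | |- cmeas (fun _ => (_ + _)%R) => apply: cmeasD
  | |- cmeas (fun _ => (_ * _)%R) => apply: cmeasM
  | |- cmeas (fun _ => (- _)%R) => apply: cmeasN
  | |- _ => assumption
  end.

(** * Families of independent coordinates *)

Section CoordinateSpace.
Context (R : realType) (K : finType).

(** Rectangles, the pi-system that generates the product sigma-algebra. *)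
Definition box : set (set (K -> R)) :=
  [set C | exists2 B : K -> set R, (forall k, measurable (B k)) &
                                   C = [set x : K -> R | forall k, B k (x k)]].

Definition coord_space := g_sigma_algebraType box.
HB.instance Definition _ := Measurable.on coord_space.
Local Notation V := coord_space.

Lemma box_setI : setI_closed box.
Proof.
move=> _ _ [A mA ->] [B mB ->]; exists (fun k => A k `&` B k).
  by move=> k; exact: measurableI.
by apply/seteqP; split => x /= => [[a b] k|h]; [split|split=> k; have [] := h k].
Qed.

Lemma boxT : box setT.
Proof. by exists (fun=> setT) => //; apply/seteqP; split. Qed.

Lemma measurable_box (B : K -> set R) : (forall k, measurable (B k)) ->
  measurable ([set x : K -> R | forall k, B k (x k)] : set V).
Proof. by move=> mB; apply: sub_sigma_algebra; exists B. Qed.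

Lemma measurable_coord k : measurable_fun setT (fun x : V => x k).
Proof.
move=> _ B mB; rewrite setTI.
rewrite (_ : _ @^-1` B = [set x : K -> R | forall j, (if j == k then B else setT) (x j)]).
  by apply: (@measurable_box (fun j => if j == k then B else setT)) => j; case: ifP.
apply/seteqP; split => x /=; first by move=> xB j; case: eqVneq => // ->.
by move/(_ k); rewrite eqxx.
Qed.

Lemma measurable_to_coord d (T : measurableType d) (f : T -> V) :
  (forall k, measurable_fun setT (fun w => f w k)) -> measurable_fun setT f.
Proof.
move=> mf; apply: (measurability (box : set (set V))) => //.
move=> _ [_ [B mB ->] <-].
rewrite (_ : _ `&` _ = \bigcap_(k in setT) ((fun w => f w k) @^-1` B k)).
  apply: fin_bigcap_measurable => // k _.
  by rewrite -[X in measurable X]setTI; exact: mf.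
by apply/seteqP; split => w /= => [[_ h] k _|h]; [exact: h|split => // k; exact: h].
Qed.

Lemma measure_box_unique (m1 m2 : {measure set V -> \bar R}) :
  (m1 setT < +oo)%E ->
  (forall B : K -> set R, (forall k, measurable (B k)) ->
    m1 [set x : K -> R | forall k, B k (x k)] = m2 [set x : K -> R | forall k, B k (x k)]) ->
  forall A, measurable A -> m1 A = m2 A.
Proof.
move=> m1oo m12; apply: (measure_unique (box : set (set V)) (fun=> setT)) => //.
- exact: box_setI.
- by move=> _; exact: boxT.
- by rewrite bigcup_const.
- by move=> _ [B mB ->]; exact: m12.
Qed.

Definition set_coord (x : V) (k : K) (t : R) : V := fun j => if j == k then t else x j.

Lemma measurable_set_coord k : measurable_fun setT (fun p : V * R => set_coord p.1 k p.2).
Proof.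
apply: measurable_to_coord => j; rewrite /set_coord.
case: eqVneq => _; first exact: measurable_snd.
by apply: (measurableT_comp (measurable_coord j)); exact: measurable_fst.
Qed.

Definition product_law (gam : K -> set R -> \bar R) (m : set V -> \bar R) :=
  forall B : K -> set R, (forall k, measurable (B k)) ->
    m [set x : K -> R | forall k, B k (x k)] = (\prod_k gam k (B k))%E.

Section Independent.
Context (m : probability V R) (gam : K -> probability (measurableTypeR R) R).
Hypothesis m_law : product_law (fun k => gam k) m.

(** The law is a product, so it is the image of itself times [gam k] under the map
    that overwrites coordinate [k]; Tonelli then lets a single coordinate be
    integrated out first. *)
Lemma integral_resample k (h : V -> \bar R) : measurable_fun setT h ->
  (forall x, 0 <= h x)%E ->
  (\int[m]_x h x = \int[m]_x \int[gam k]_t h (set_coord x k t))%E.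
Proof.
move=> mh h0.
pose phi (p : V * R) := set_coord p.1 k p.2.
have mphi : measurable_fun setT phi := measurable_set_coord k.
transitivity (\int[pushforward (m \x gam k) phi]_x h x)%E.
  apply: eq_measure_integral => A mA _.
  apply: measure_box_unique => //; first by rewrite [X in (X < _)%E]probability_setT ltry.
  move=> B mB; rewrite [LHS]m_law//= /pushforward.
  rewrite (_ : phi @^-1` _ =
    [set x : K -> R | forall j, (if j == k then setT else B j) (x j)] `*` B k); last first.
    apply/seteqP; split => [[x t] /= h1|[x t] /= [h1 h2] j].
      split; last by have := h1 k; rewrite /phi /set_coord eqxx.
      by move=> j; have := h1 j; rewrite /phi /set_coord /=; case: ifP.
    by have := h1 j; rewrite /phi /set_coord /=; case: eqVneq => // ->.
  have mB' j : measurable (if j == k then setT else B j) by case: ifP.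
  rewrite product_measure1E; last exact: mB; last first.
    exact: (@measurable_box (fun j => if j == k then setT else B j)).
  transitivity ((\prod_j gam j (if j == k then setT else B j)) * gam k (B k))%E; last first.
    by congr (_ * _)%E; exact: (esym (m_law mB')).
  rewrite (bigD1 k)//= [in RHS](bigD1 k)//= eqxx probability_setT mul1e muleC.
  by congr (_ * _)%E; apply: eq_bigr => j /negPf ->.
rewrite ge0_integral_pushforward//= preimage_setT.
by rewrite fubini_tonelli1//; exact: measurableT_comp.
Qed.

End Independent.

Section GaussianCoordinates.
Context (m : probability V R) (sigma : K -> R) (sigma_gt0 : forall k, 0 < sigma k).
Hypothesis m_law : product_law (fun k => normal_prob 0 (sigma k)) m.

(** The coefficients do not depend on coordinate [k], so after resampling that
    coordinate they are constants of the inner integral. *)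
Lemma integral_gaussian_coord (k : K) (h0 h1 h2 : V -> R[i]) :
  cmeas h0 -> cmeas h1 -> cmeas h2 ->
  (forall x t, h0 (set_coord x k t) = h0 x) ->
  (forall x t, h1 (set_coord x k t) = h1 x) ->
  (forall x t, h2 (set_coord x k t) = h2 x) ->
  (\int[m]_x (sqn (h0 x + h1 x * (x k)%:C + h2 x * (x k ^+ 2)%:C))%:E =
   \int[m]_x (sqn (h0 x + (sigma k ^+ 2)%:C * h2 x) + sigma k ^+ 2 * sqn (h1 x)
    + 2 * sigma k ^+ 4 * sqn (h2 x))%:E)%E.
Proof.
move=> m0 m1 m2 u0 u1 u2.
rewrite (@integral_resample m (fun k => normal_prob (0:R) (sigma k)) m_law k); last 2 first.
- apply: measurable_sqn; apply: cmeasD.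
    by apply: cmeasD => //; apply: cmeasM => //; apply: cmeas_real; exact: measurable_coord.
  apply: cmeasM => //; apply: cmeas_real; apply: measurable_funX; exact: measurable_coord.
- by move=> x; rewrite lee_fin sqn_ge0.
apply: eq_integral => x _.
rewrite -integral_normal_sqn//.
by apply: eq_integral => t _; rewrite u0 u1 u2 /set_coord eqxx.
Qed.

End GaussianCoordinates.
End CoordinateSpace.

(** * Equality of integrals of nonnegative functions *)

Section SameIntegral.
Context d (T : measurableType d) (R : realType) (m : {measure set T -> \bar R}).
Implicit Types F G : T -> R.

Definition nnmeas F := measurable_fun setT F /\ forall x, 0 <= F x.

Lemma nnmeasD F G : nnmeas F -> nnmeas G -> nnmeas (fun x => F x + G x).
Proof.
move=> [mF F0] [mG G0]; split; first exact: measurable_funD.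
by move=> x; exact: addr_ge0.
Qed.

Lemma nnmeasZ c F : 0 <= c -> nnmeas F -> nnmeas (fun x => c * F x).
Proof.
move=> c0 [mF F0]; split; first exact: measurable_funM.
by move=> x; exact: mulr_ge0.
Qed.

Lemma nnmeas_sqn (h : T -> R[i]) : cmeas h -> nnmeas (fun x => sqn (h x)).
Proof.
by move=> mh; split => [|x]; [apply/measurable_EFinP; exact: measurable_sqn|exact: sqn_ge0].
Qed.

(** Equality of integrals alone is not compatible with sums, since additivity of
    the integral needs measurability and a sign; carrying both makes the relation
    a congruence. *)
Definition same_int F G := [/\ nnmeas F, nnmeas G &
  (\int[m]_x (F x)%:E = \int[m]_x (G x)%:E)%E].

Lemma same_int_ext F G : nnmeas F -> F =1 G -> same_int F G.
Proof. by move=> nF FG; have <- : F = G by apply/funext. Qed.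

Lemma same_int_refl F : nnmeas F -> same_int F F.
Proof. by []. Qed.

Lemma same_int_trans G F H : same_int F G -> same_int G H -> same_int F H.
Proof. by move=> [a b c] [e f g]; split => //; rewrite c. Qed.

Lemma same_int_eqr F G H : same_int H F -> F =1 G -> same_int H G.
Proof. by move=> HF FG; have <- : F = G by apply/funext. Qed.

Lemma same_intD F1 G1 F2 G2 : same_int F1 G1 -> same_int F2 G2 ->
  same_int (fun x => F1 x + F2 x) (fun x => G1 x + G2 x).
Proof.
move=> [nF1 nG1 h1] [nF2 nG2 h2]; split; [exact: nnmeasD|exact: nnmeasD|].
move: nF1 nG1 nF2 nG2 => [mF1 F10] [mG1 G10] [mF2 F20] [mG2 G20].
under eq_integral do rewrite EFinD.
under [RHS]eq_integral do rewrite EFinD.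
rewrite !ge0_integralD//; try by move=> x _; rewrite lee_fin.
- by rewrite h1 h2.
all: exact/measurable_EFinP.
Qed.

Lemma same_intZ c F G : 0 <= c ->
  same_int F G -> same_int (fun x => c * F x) (fun x => c * G x).
Proof.
move=> c0 [nF nG h]; split; [exact: nnmeasZ|exact: nnmeasZ|].
move: nF nG => [mF F0] [mG G0].
under eq_integral do rewrite EFinM.
under [RHS]eq_integral do rewrite EFinM.
rewrite !ge0_integralZl_EFin//; try by move=> x _; rewrite lee_fin.
- by rewrite h.
all: exact/measurable_EFinP.
Qed.

End SameIntegral.

(** * Averaging over one block of an elliptic matrix *)

Section Blocks.
Context (R : realType) (K : finType).
Local Notation V := (coord_space R K).
Context (m : probability V R) (sigma : K -> R) (sigma_gt0 : forall k, 0 < sigma k).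
Hypothesis m_law : product_law (fun k => normal_prob 0 (sigma k)) m.
Local Notation "F ~~ G" := (same_int m F G) (at level 70).

Definition free_of (k : K) (U : Type) (h : V -> U) := forall x t, h (set_coord x k t) = h x.

Lemma cmeas_coord k : cmeas (fun x : V => (x k)%:C).
Proof. by apply: cmeas_real; exact: measurable_coord. Qed.

Lemma same_int_gaussian_coord k (h0 h1 h2 : V -> R[i]) :
  cmeas h0 -> cmeas h1 -> cmeas h2 ->
  free_of k h0 -> free_of k h1 -> free_of k h2 ->
  (fun x => sqn (h0 x + h1 x * (x k)%:C + h2 x * (x k ^+ 2)%:C)) ~~
  (fun x => sqn (h0 x + (sigma k ^+ 2)%:C * h2 x) + sigma k ^+ 2 * sqn (h1 x)
    + 2 * sigma k ^+ 4 * sqn (h2 x)).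
Proof.
move=> m0 m1 m2 f0 f1 f2.
have mk2 : cmeas (fun x : V => (x k ^+ 2)%:C).
  by apply: cmeas_real; apply: measurable_funX; exact: measurable_coord.
have mk := cmeas_coord k.
split; last exact: integral_gaussian_coord.
  by apply: nnmeas_sqn; solve_cmeas.
apply: nnmeasD; [apply: nnmeasD|]; try (apply: nnmeasZ; last exact: nnmeas_sqn).
- by apply: nnmeas_sqn; solve_cmeas.
- exact: sqr_ge0.
- by rewrite mulr_ge0// exprn_even_ge0.
Qed.

Section Complex.
Variables (k1 k2 : K) (rho : R).
Hypotheses (k1_neq_k2 : k1 != k2).
Hypotheses (rho1 : sigma k1 ^+ 2 *+ 2 = rho) (rho2 : sigma k2 ^+ 2 *+ 2 = rho).

Let p (x : V) : R[i] := x k1 +i* x k2.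

Lemma cmeas_pair : cmeas p.
Proof. by split; exact: measurable_coord. Qed.

Lemma cmeas_pair_conj : cmeas (fun x => (p x)^*%C).
Proof.
split; first exact: measurable_coord.
by apply: measurableT_comp => //; exact: measurable_coord.
Qed.

(** For a centred complex Gaussian $p$ with $E|p|^2=\rho$ and $E(p^2)=0$, the
    functions $1$, $p$, $\bar p$ and $|p|^2-\rho$ are orthogonal with squared norms
    $1$, $\rho$, $\rho$ and $\rho^2$. *)
Lemma same_int_complex_gaussian (A B C D : V -> R[i]) :
  cmeas A -> cmeas B -> cmeas C -> cmeas D ->
  free_of k1 A -> free_of k1 B -> free_of k1 C -> free_of k1 D ->
  free_of k2 A -> free_of k2 B -> free_of k2 C -> free_of k2 D ->
  (fun x => sqn (A x + B x * p x + C x * (p x)^*%C + D x * (p x * (p x)^*%C))) ~~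
  (fun x => sqn (A x + rho%:C * D x) + rho * sqn (B x) + rho * sqn (C x) + rho ^+ 2 * sqn (D x)).
Proof.
move=> mA mB mC mD A1 B1 C1 D1 A2 B2 C2 D2.
pose v := sigma k1 ^+ 2.
have v2 : sigma k2 ^+ 2 = v.
  by have := rho2; rewrite -rho1 /v !mulr2n; lra.
have v0 : 0 <= v by rewrite sqr_ge0.
have rhoE : rho = 2 * v by rewrite -rho1 mulr_natl.
(* As a polynomial in the real part of p, the function has coefficients h0, h1
   and D; h0 is in turn a polynomial in the imaginary part, with linear
   coefficient g1. *)
pose h1 x := B x + C x.
pose g1 x := (0 +i* 1) * (B x - C x).
pose h0 x := A x + g1 x * (x k2)%:C + D x * (x k2 ^+ 2)%:C.
have mh1 : cmeas h1 by exact: cmeasD.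
have mg1 : cmeas g1 by apply: cmeasM; [exact: cmeas_cst|exact: cmeasB].
have m2 : cmeas (fun x : V => (x k2 ^+ 2)%:C).
  by apply: cmeas_real; apply: measurable_funX; exact: measurable_coord.
have mk1 := cmeas_coord k1; have mk2 := cmeas_coord k2.
have mp := cmeas_pair; have mpc := cmeas_pair_conj.
have mh0 : cmeas h0 by rewrite /h0; solve_cmeas.
have E1 x : sqn (A x + B x * p x + C x * (p x)^*%C + D x * (p x * (p x)^*%C)) =
   sqn (h0 x + h1 x * (x k1)%:C + D x * (x k1 ^+ 2)%:C).
  congr sqn; rewrite /h0 /h1 /g1 /p.
  case: (A x) (B x) (C x) (D x) => a a' [b b'] [c c'] [e e'].
  by apply/eqP; rewrite eq_complex /=; apply/andP; split; apply/eqP; ring.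
apply: (same_int_trans (same_int_ext _ _ E1)); first by apply: nnmeas_sqn; solve_cmeas.
apply: same_int_trans.
  apply: same_int_gaussian_coord => //.
  - move=> x t; rewrite /h0 /g1 A1 B1 C1 D1 /set_coord.
    by rewrite eq_sym (negPf k1_neq_k2).
  - by move=> x t; rewrite /h1 B1 C1.
have E2 x : sqn (h0 x + (sigma k1 ^+ 2)%:C * D x) + sigma k1 ^+ 2 * sqn (h1 x)
     + 2 * sigma k1 ^+ 4 * sqn (D x) =
   sqn ((A x + v%:C * D x) + g1 x * (x k2)%:C + D x * (x k2 ^+ 2)%:C)
     + (v * sqn (h1 x) + 2 * v ^+ 2 * sqn (D x)).
  rewrite -/v -addrA; congr (sqn _ + (_ + _ * _)).
    by rewrite /h0; ring.
  by rewrite /v -exprM.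
have w0 : 0 <= 2 * v ^+ 2 by rewrite mulr_ge0 ?sqr_ge0.
have w1 : 0 <= 2 * sigma k1 ^+ 4 by rewrite mulr_ge0 ?exprn_even_ge0.
have n1 : nnmeas (fun x => v * sqn (h1 x) + 2 * v ^+ 2 * sqn (D x)).
  by apply: nnmeasD; (apply: nnmeasZ; last exact: nnmeas_sqn).
apply: (same_int_trans (same_int_ext _ _ E2)).
  apply: nnmeasD; [apply: nnmeasD|]; try (apply: nnmeasZ => //; exact: nnmeas_sqn).
  by apply: nnmeas_sqn; solve_cmeas.
apply: same_int_eqr.
  apply: same_intD; last exact: (same_int_refl _ n1).
  apply: same_int_gaussian_coord => //.
  - by solve_cmeas.
  - by move=> x t; rewrite A2 D2.
  - by move=> x t; rewrite /g1 B2 C2.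
move=> x.
rewrite (_ : sigma k2 ^+ 4 = v ^+ 2); last by rewrite -v2 -exprM.
rewrite v2 /h1 /g1 rhoE /sqn.
case: (A x) (B x) (C x) (D x) => a a' [b b'] [c c'] [e e'] /=; ring.
Qed.

End Complex.

Lemma free_of_coord k k' : k' != k -> free_of k (fun x : V => x k').
Proof. by move=> kk x t; rewrite /set_coord (negPf kk). Qed.

Section OffDiagonal.
Variables (k1 k2 k3 k4 : K) (rho : R).
Hypothesis k_uniq : uniq [:: k1; k2; k3; k4].
Hypothesis rhoE : forall k, k \in [:: k1; k2; k3; k4] -> sigma k ^+ 2 *+ 2 = rho.
Variables (a b : R) (e : R[i]).
Hypothesis e1 : sqn e = 1.

Let p (x : V) : R[i] := x k1 +i* x k2.
Let q (x : V) : R[i] := x k3 +i* x k4.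
Let u x := e * (a%:C * p x + (0 +i* b) * q x).
Let v x := e * (a%:C * (p x)^*%C + (0 +i* b) * (q x)^*%C).
Let r : R := rho * (a ^+ 2 + b ^+ 2).
Let c : R[i] := rho%:C * (e ^+ 2 * (a ^+ 2 - b ^+ 2)%:C).

(** The entries $u$ and $v$ in opposite positions are centred Gaussians with
    $E|u|^2=E|v|^2=r$, $E(uv)=c$ and $E(u^2)=E(v^2)=E(u\bar v)=0$, so that $1$, $u$,
    $v$ and $uv-c$ are orthogonal with squared norms $1$, $r$, $r$ and $r^2$.  The
    proof integrates over the entry [p] of one Hermitian matrix and then over the
    entry [q] of the other. *)
Lemma same_int_offdiag_block (al be ga de : V -> R[i]) :
  cmeas al -> cmeas be -> cmeas ga -> cmeas de ->
  (forall k, k \in [:: k1; k2; k3; k4] ->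
    [/\ free_of k al, free_of k be, free_of k ga & free_of k de]) ->
  (fun x => sqn (al x + be x * u x + ga x * v x + de x * (u x * v x))) ~~
  (fun x => sqn (al x + c * de x) + r * sqn (be x) + r * sqn (ga x)
     + r ^+ 2 * sqn (de x)).
Proof.
move=> mal mbe mga mde fr.
have rho0 : 0 <= rho by rewrite -(rhoE (mem_head _ _)) mulrn_wge0 ?sqr_ge0.
(* A, B, C and D are the coefficients of 1, p, its conjugate and |p|^2.  The zero
   terms give each of them the shape to which the integration over q applies. *)
pose A x := al x + (0 +i* b) * e * be x * q x + (0 +i* b) * e * ga x * (q x)^*%C
   + - (b ^+ 2)%:C * e ^+ 2 * de x * (q x * (q x)^*%C).
pose B x := a%:C * e * be x + 0 * q x
   + a%:C * (0 +i* b) * e ^+ 2 * de x * (q x)^*%C + 0 * (q x * (q x)^*%C).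
pose C x := a%:C * e * ga x + a%:C * (0 +i* b) * e ^+ 2 * de x * q x
   + 0 * (q x)^*%C + 0 * (q x * (q x)^*%C).
pose D x := (a ^+ 2)%:C * e ^+ 2 * de x.
have mq : cmeas q by exact: cmeas_pair.
have mqc : cmeas (fun x => (q x)^*%C) by exact: cmeas_pair_conj.
have mp : cmeas p by exact: cmeas_pair.
have mpc : cmeas (fun x => (p x)^*%C) by exact: cmeas_pair_conj.
have mu : cmeas u by rewrite /u; solve_cmeas.
have mv : cmeas v by rewrite /v; solve_cmeas.
have mA : cmeas A by rewrite /A; solve_cmeas.
have mB : cmeas B by rewrite /B; solve_cmeas.
have mC : cmeas C by rewrite /C; solve_cmeas.
have mD : cmeas D by rewrite /D; solve_cmeas.
have [f1 f2 f3 f4] : [/\ k1 \in [:: k1; k2; k3; k4], k2 \in [:: k1; k2; k3; k4],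
  k3 \in [:: k1; k2; k3; k4] & k4 \in [:: k1; k2; k3; k4]].
  by rewrite !inE !eqxx !orbT.
have E1 x : sqn (al x + be x * u x + ga x * v x + de x * (u x * v x)) =
  sqn (A x + B x * p x + C x * (p x)^*%C + D x * (p x * (p x)^*%C)).
  congr sqn; rewrite /A /B /C /D /u /v.
  have -> : - (b ^+ 2)%:C = (0 +i* b) * (0 +i* b) :> R[i] by simpc; rewrite -expr2.
  have -> : (a ^+ 2)%:C = a%:C * a%:C :> R[i] by simpc; rewrite -expr2.
  by ring.
apply: (same_int_trans (same_int_ext _ _ E1)); first by apply: nnmeas_sqn; solve_cmeas.
have [kk1 kk2 kk3 kk4] : [/\ k3 != k1, k3 != k2, k4 != k1 & k4 != k2].
  move: k_uniq; rewrite /= !inE !negb_or => /and4P[/and3P[h1 h2 h3] /andP[h4 h5] _ _].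
  by rewrite ![_ == k1]eq_sym ![_ == k2]eq_sym.
have [k1_neq_k2 k34] : k1 != k2 /\ k3 != k4.
  by move: k_uniq; rewrite /= !inE !negb_or => /and4P[/and3P[h1 h2 h3] /andP[h4 h5] h6 _].
have fq1 x t : q (set_coord x k1 t) = q x by rewrite /q !free_of_coord.
have fq2 x t : q (set_coord x k2 t) = q x by rewrite /q !free_of_coord.
have [F1 F2 F3 F4] := fr _ f1.
have [G1 G2 G3 G4] := fr _ f2.
have [H1 H2 H3 H4] := fr _ f3.
have [I1 I2 I3 I4] := fr _ f4.
apply: same_int_trans.
  apply: (same_int_complex_gaussian k1_neq_k2 (rhoE f1) (rhoE f2)) => // x t;
    by rewrite /A /B /C /D ?fq1 ?fq2 ?F1 ?F2 ?F3 ?F4 ?G1 ?G2 ?G3 ?G4.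
have E2 x : sqn (A x + rho%:C * D x) =
  sqn ((al x + rho%:C * D x) + (0 +i* b) * e * be x * q x + (0 +i* b) * e * ga x * (q x)^*%C
   + - (b ^+ 2)%:C * e ^+ 2 * de x * (q x * (q x)^*%C)).
  by congr sqn; rewrite /A; ring.
apply: same_int_eqr.
  apply: same_intD; [apply: same_intD; [apply: same_intD|]|].
  - apply: (same_int_trans (same_int_ext _ _ E2)); first by apply: nnmeas_sqn; solve_cmeas.
    apply: (same_int_complex_gaussian k34 (rhoE f3) (rhoE f4)); rewrite /D; try solve_cmeas;
        by move=> x t; rewrite ?H1 ?H2 ?H3 ?H4 ?I1 ?I2 ?I3 ?I4.
  - apply: (same_intZ rho0); rewrite /B.
    apply: (same_int_complex_gaussian k34 (rhoE f3) (rhoE f4)); try solve_cmeas;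
        by move=> x t; rewrite ?H1 ?H2 ?H3 ?H4 ?I1 ?I2 ?I3 ?I4.
  - apply: (same_intZ rho0); rewrite /C.
    apply: (same_int_complex_gaussian k34 (rhoE f3) (rhoE f4)); try solve_cmeas;
        by move=> x t; rewrite ?H1 ?H2 ?H3 ?H4 ?I1 ?I2 ?I3 ?I4.
  - apply: same_int_refl; apply: nnmeasZ; first exact: sqr_ge0.
    exact: nnmeas_sqn.
move=> x.
have Ec : al x + rho%:C * D x + rho%:C * (- (b ^+ 2)%:C * e ^+ 2 * de x) = al x + c * de x.
  by rewrite /c /D rmorphB /=; ring.
rewrite /= Ec !mulr0 !addr0 /D expr2 ?sqnM sqn0 sqnN !sqn_real !sqn_im e1 /r.
ring.
Qed.

End OffDiagonal.

Section Diagonal.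
Variables (k1 k2 : K) (rho : R).
Hypothesis k1_neq_k2 : k1 != k2.
Hypotheses (rho1 : sigma k1 ^+ 2 = rho) (rho2 : sigma k2 ^+ 2 = rho).
Variables (a b : R) (e : R[i]).
Hypothesis e1 : sqn e = 1.

(** The function is affine in the diagonal entry, which is centred, so only its
    mean squared modulus matters. *)
Lemma same_int_diag_block (al be : V -> R[i]) :
  cmeas al -> cmeas be -> free_of k1 al -> free_of k1 be ->
  free_of k2 al -> free_of k2 be ->
  (fun x => sqn (al x + be x * (e * (a%:C * (x k1)%:C + (0 +i* b) * (x k2)%:C)))) ~~
  (fun x => sqn (al x) + rho * (a ^+ 2 + b ^+ 2) * sqn (be x)).
Proof.
move=> mal mbe fa1 fb1 fa2 fb2.
have mk1 := cmeas_coord k1; have mk2 := cmeas_coord k2.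
have fk : free_of k1 (fun x : V => x k2) by apply: free_of_coord; rewrite eq_sym.
have E1 x : sqn (al x + be x * (e * (a%:C * (x k1)%:C + (0 +i* b) * (x k2)%:C))) =
  sqn ((al x + be x * e * (0 +i* b) * (x k2)%:C)
    + be x * e * a%:C * (x k1)%:C + 0 * (x k1 ^+ 2)%:C).
  by congr sqn; ring.
apply: (same_int_trans (same_int_ext _ _ E1)); first by apply: nnmeas_sqn; solve_cmeas.
apply: same_int_eqr.
  apply: same_int_trans.
    apply: same_int_gaussian_coord; try solve_cmeas; move=> x t //.
      by rewrite fa1 fb1 fk.
    by rewrite fb1.
  apply: same_intD; [apply: same_intD|].
  - have E2 x : sqn (al x + be x * e * (0 +i* b) * (x k2)%:C + (sigma k1 ^+ 2)%:C * 0) =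
      sqn (al x + be x * e * (0 +i* b) * (x k2)%:C + 0 * (x k2 ^+ 2)%:C) by congr sqn; ring.
    apply: (same_int_trans (same_int_ext _ _ E2)); first by apply: nnmeas_sqn; solve_cmeas.
    apply: same_int_gaussian_coord; try solve_cmeas; move=> x t //.
    by rewrite fb2.
  - apply: same_int_refl; apply: nnmeasZ; first exact: sqr_ge0.
    by apply: nnmeas_sqn; solve_cmeas.
  - apply: same_int_refl; apply: nnmeasZ; first by rewrite mulr_ge0 ?exprn_even_ge0.
    by apply: nnmeas_sqn; solve_cmeas.
move=> x; rewrite /= !mulr0 addr0 !sqnM sqn0 sqn_real sqn_im e1 rho1 rho2; ring.
Qed.

End Diagonal.

End Blocks.

(** * Exponentials of commuting nilpotent operators *)

Section NilpotentExponential.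
Context (F : numFieldType) (W : lmodType F) (I : Type) (B : I -> {linear W -> W}).
Hypothesis B_comm : forall i j w, B i (B j w) = B j (B i w).

(** Written for a list, so that the exponential can be built one operator at a
    time. *)
Definition opsum (s : seq I) (w : W) := \sum_(i <- s) B i w.

Lemma opsum_comm s i w : opsum s (B i w) = B i (opsum s w).
Proof. by rewrite /opsum raddf_sum; apply: eq_bigr => j _; exact: B_comm. Qed.

Lemma opsumD s w1 w2 : opsum s (w1 + w2) = opsum s w1 + opsum s w2.
Proof. by rewrite /opsum -big_split; apply: eq_bigr => j _; exact: raddfD. Qed.

Lemma opsumZ s (c : F) w : opsum s (c *: w) = c *: opsum s w.
Proof. by rewrite /opsum scaler_sumr; apply: eq_bigr => j _; exact: linearZ. Qed.

Lemma opsumMn s w n : opsum s (w *+ n) = opsum s w *+ n.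
Proof. by rewrite -scaler_nat opsumZ scaler_nat. Qed.

Lemma opsum_iter_comm s i k w : iter k (opsum s) (B i w) = B i (iter k (opsum s) w).
Proof. by elim: k => //= k ->; exact: opsum_comm. Qed.

Context (v : W).
Hypothesis B_sqr0 : forall i, B i (B i v) = 0.

Lemma opsum_sqr0 s i k : B i (B i (iter k (opsum s) v)) = 0.
Proof.
rewrite -!opsum_iter_comm B_sqr0; elim: k => //= k ->.
by rewrite /opsum big1// => j _; exact: raddf0.
Qed.

(** The binomial formula for two commuting operators, in which the terms of
    degree two and more in [B i] vanish. *)
Lemma iter_opsum_cons i s k : iter k.+1 (opsum (i :: s)) v =
  iter k.+1 (opsum s) v + B i (iter k (opsum s) v) *+ k.+1.
Proof.
have cE w : opsum (i :: s) w = B i w + opsum s w by rewrite /opsum big_cons.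
elim: k => [|k IH]; first by rewrite /= cE addrC.
rewrite iterS IH cE raddfD /= raddfMn /= opsum_sqr0 mul0rn addr0.
by rewrite opsumD opsumMn opsum_comm addrCA -mulrS.
Qed.

(** On [v], $1+cB_i$ is $\exp(cB_i)$ because $B_i^2$ vanishes, and exponents of
    commuting operators add up.  The series may be cut at any order above the
    number of operators, since a longer product repeats some $B_i$. *)
Lemma prod_one_plus_nilpotent (c : F) (s : seq I) (n : nat) : (size s < n)%N ->
  foldr (fun i w => w + c *: B i w) v s =
  \sum_(k < n) (k`!%:R^-1 * c ^+ k) *: iter k (opsum s) v.
Proof.
elim: s n => [|i s IH] [//|n] /= sn.
  rewrite big_ord_recl /= expr0 fact0 invr1 mulr1 scale1r big1 ?addr0// => k _.
  by rewrite /opsum big_nil scaler0.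
have {2}-> := IH n sn; rewrite (IH n.+1 (ltnW sn)).
rewrite !big_ord_recl /= -addrA; congr (_ + _).
rewrite raddf_sum scaler_sumr -big_split; apply: eq_bigr => k _.
rewrite !add0n /bump /= add1n -!iterS iter_opsum_cons scalerDr; congr (_ + _).
rewrite linearZ /= -[B i _ *+ _]scaler_nat !scalerA; congr (_ *: _).
rewrite factS natrM invfM exprS.
field.
by rewrite pnatr_eq0 -lt0n fact_gt0 /= -[1]/(1%:R) -natrD pnatr_eq0.
Qed.

End NilpotentExponential.

(** * Entrywise differences of the characteristic polynomial *)

Section FiniteDifference.
Context (F : numFieldType) (N : nat).
Local Notation W := ('M[F]_N -> F^o).
Implicit Types (h : W) (i j : 'I_N).

(** On functions that are affine in each entry this is the partial derivative with
    respect to entry $(i,j)$; the finite difference makes sense for all functions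
    and is linear without further hypotheses.  The codomain is the regular module
    so that functions form a vector space. *)
Definition diffq i j h : W := fun M => h (M + delta_mx i j) - h M.

Lemma diffq_is_linear i j : linear (diffq i j).
Proof.
move=> c f g; apply/funext => M; rewrite /diffq /= !fctE.
rewrite /GRing.scale /=; ring.
Qed.
HB.instance Definition _ i j := GRing.isLinear.Build F W W _ (diffq i j) (diffq_is_linear i j).

Lemma diffqC i j k l h : diffq i j (diffq k l h) = diffq k l (diffq i j h).
Proof.
apply/funext => M; rewrite /diffq.
by rewrite [M + _ + _]addrAC !opprB !addrA; ring.
Qed.

Definition multiaffine h := forall i j t M,
  h (M + t *: delta_mx i j) = h M + t * diffq i j h M.

Lemma multiaffine_diffq i j h : multiaffine h -> multiaffine (diffq i j h).
Proof.
move=> ha k l t M.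
rewrite {1}/diffq addrAC !ha.
rewrite diffqC [diffq k l _ M]/diffq -/(diffq k l h _).
rewrite /diffq; ring.
Qed.

Lemma diffq_sqr0 i j h : multiaffine h -> diffq i j (diffq i j h) = 0.
Proof.
move=> ha; apply/funext => M.
have := ha i j 2 M; rewrite scaler_nat mulr2n addrA => e.
rewrite /diffq e /diffq.
by transitivity (0 : F) => //; ring.
Qed.

(** The operator $\partial_{ij}\partial_{ji}$. *)
Definition mixdiff (b : 'I_N * 'I_N) h := diffq b.1 b.2 (diffq b.2 b.1 h).
HB.instance Definition _ b := GRing.Linear.copy (mixdiff b) (diffq b.1 b.2 \o diffq b.2 b.1).

Lemma multiaffineD h g : multiaffine h -> multiaffine g -> multiaffine (h + g).
Proof.
move=> hh hg i j t M; rewrite raddfD /= !fctE hh hg; ring.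
Qed.

Lemma multiaffineZ c h : multiaffine h -> multiaffine (c *: h).
Proof.
move=> hh i j t M; rewrite linearZ /= !fctE hh /GRing.scale /=; ring.
Qed.

Lemma mixdiffC a b h : mixdiff a (mixdiff b h) = mixdiff b (mixdiff a h).
Proof. by rewrite /mixdiff !(diffqC a.1) !(diffqC a.2). Qed.

Lemma mixdiff_sqr0 b h : multiaffine h -> mixdiff b (mixdiff b h) = 0.
Proof.
move=> ha; rewrite /mixdiff (diffqC b.2 b.1) diffq_sqr0//.
by do 2 apply: multiaffine_diffq.
Qed.

Lemma mixdiff_diag i h : multiaffine h -> mixdiff (i, i) h = 0.
Proof. by move=> ha; rewrite /mixdiff /= diffq_sqr0. Qed.

Section DetRow.
(** Row [i] replaced by the [j]-th basis vector: the determinant of this matrix is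
    the cofactor at $(i,j)$. *)
Definition setrow i j (A : 'M[F]_N) := \matrix_(k, l) if k == i then (j == l)%:R else A k l.

Lemma det_sub_delta i j A : \det (A - delta_mx i j) = \det A - \det (setrow i j A).
Proof.
rewrite -[\det A]mul1r -[- \det _]mulN1r.
apply: (@determinant_multilinear _ _ _ A (setrow i j A) i).
- by apply/rowP => l; rewrite !mxE !eqxx /= (eq_sym j); ring.
- apply/matrixP => k l; rewrite !mxE (_ : (lift i k == i) = false) ?subr0//.
  by rewrite eq_sym; apply/negbTE; exact: neq_lift.
- apply/matrixP => k l; rewrite !mxE (_ : (lift i k == i) = false) ?subr0//.
  by rewrite eq_sym; apply/negbTE; exact: neq_lift.
Qed.

Definition shifted_det (z : F) : W := fun M => \det (z%:M - M).

Lemma diffq_shifted_det z i j M : diffq i j (shifted_det z) M = - \det (setrow i j (z%:M - M)).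
Proof.
by rewrite /diffq /shifted_det opprD addrA det_sub_delta addrAC subrr add0r.
Qed.

Lemma multiaffine_shifted_det z : multiaffine (shifted_det z).
Proof.
move=> i j t M; rewrite diffq_shifted_det /shifted_det.
rewrite -[\det (z%:M - M)]mul1r mulrN -mulNr.
apply: (@determinant_multilinear _ _ _ (z%:M - M) (setrow i j (z%:M - M)) i).
- by apply/rowP => l; rewrite !mxE !eqxx /= (eq_sym j); ring.
- apply/matrixP => k l; rewrite !mxE (_ : (lift i k == i) = false) ?mulr0 ?addr0//.
  by rewrite eq_sym; apply/negbTE; exact: neq_lift.
- apply/matrixP => k l; rewrite !mxE (_ : (lift i k == i) = false) ?mulr0 ?addr0//.
  by rewrite eq_sym; apply/negbTE; exact: neq_lift.
Qed.

Lemma diffq2_shifted_det z i j k l M : i != k ->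
  diffq i j (diffq k l (shifted_det z)) M = \det (setrow i j (setrow k l (z%:M - M))).
Proof.
move=> ik; rewrite {1}/diffq !diffq_shifted_det.
have -> : setrow k l (z%:M - (M + delta_mx i j)) = setrow k l (z%:M - M) - delta_mx i j.
  apply/matrixP => x y; rewrite !mxE.
  have [->|_] := eqVneq x k; first by rewrite (eq_sym k) (negPf ik) subr0.
  by rewrite opprD addrA.
by rewrite det_sub_delta; ring.
Qed.

(** Both sides are determinants in which rows [i] and [j] are basis vectors; they
    differ by the exchange of these two rows. *)
Lemma mixdiff_shifted_det z i j : i != j ->
  mixdiff (i, j) (shifted_det z) = - diffq i i (diffq j j (shifted_det z)).
Proof.
move=> ij; apply/funext => M; rewrite /mixdiff /= fctE !diffq2_shifted_det//.
set A := z%:M - M.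
have -> : setrow i j (setrow j i A) = xrow i j (setrow i i (setrow j j A)).
  apply/matrixP => x y; rewrite !mxE.
  have [->|xi] := eqVneq x i.
    by rewrite tpermL [j == i]eq_sym (negPf ij) eqxx.
  have [->|xj] := eqVneq x j; first by rewrite tpermR eqxx.
  by rewrite tpermD 1?eq_sym// (negPf xi) (negPf xj).
by rewrite xrowE det_mulmx det_perm odd_tperm ij expr1 mulN1r.
Qed.
End DetRow.

(** The diagonal is included because a diagonal entry is a block of its own; its
    mixed difference is zero on multiaffine functions. *)
Definition upper_pairs : seq ('I_N * 'I_N) := [seq b : 'I_N * 'I_N <- enum predT | (b.1 <= b.2)%N].

(** On multiaffine functions, the derivative in the direction of the identity. *)
Definition trdiff h : W := \sum_(i <- index_enum 'I_N) diffq i i h.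

(** Twice the sum over unordered pairs is the sum over all pairs, in which each
    mixed difference may be replaced by a product of two diagonal ones. *)
Lemma sum_upper_mixdiff z :
  opsum mixdiff upper_pairs (shifted_det z) = (- 2^-1) *: trdiff (trdiff (shifted_det z)).
Proof.
set h := shifted_det z.
have ha : multiaffine h by exact: multiaffine_shifted_det.
have symX i j : mixdiff (i, j) h = mixdiff (j, i) h by rewrite /mixdiff /= diffqC.
have E1 : opsum mixdiff upper_pairs h + opsum mixdiff upper_pairs h =
    \sum_i \sum_j mixdiff (i, j) h.
  rewrite /opsum big_filter big_enum_cond /=.
  have -> : \sum_(b : 'I_N * 'I_N | (b.1 <= b.2)%N) mixdiff b h =
      \sum_(i < N) \sum_(j < N | (i <= j)%N) mixdiff (i, j) h.
    by rewrite pair_big_dep /=; apply: eq_big => [[]|[]].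
  rewrite [X in _ + X](exchange_big_dep predT) //= -big_split /=; apply: eq_bigr => i _.
  rewrite (bigID (fun j : 'I_N => (i <= j)%N) predT) /=; congr (_ + _).
  rewrite (bigD1 i)//= mixdiff_diag// add0r.
  apply: eq_big => [j|j _]; last exact: symX.
  by rewrite -ltnNge ltn_neqAle andbC.
have E2 : trdiff (trdiff h) = - \sum_i \sum_j mixdiff (i, j) h.
  rewrite {1}/trdiff -sumrN; apply: eq_bigr => i _.
  rewrite /trdiff raddf_sum -sumrN; apply: eq_bigr => j _.
  have [<-|ij] := eqVneq i j; first by rewrite mixdiff_diag// oppr0 /= diffq_sqr0.
  by rewrite mixdiff_shifted_det// opprK.
rewrite E2 -E1 -mulr2n scalerN scaleNr opprK.
by rewrite -[opsum _ _ _ *+ _]scaler_nat scalerA mulVf ?scale1r// pnatr_eq0.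
Qed.

Lemma trdiffE : trdiff = opsum (fun i => diffq i i) (index_enum 'I_N).
Proof. by []. Qed.

Lemma multiaffine_prod (I : Type) (B : I -> W -> W) (c : F) (s : seq I) h :
  (forall k g, multiaffine g -> multiaffine (B k g)) -> multiaffine h ->
  multiaffine (foldr (fun k w => w + c *: B k w) h s).
Proof.
move=> hB hh; elim: s => //= k s IH.
by apply: multiaffineD => //; apply: multiaffineZ; exact: hB.
Qed.

(** $1+c\,\partial_{ii}$ translates the [i]-th diagonal entry by $c$. *)
Lemma diagonal_shift (c : F) (s : seq 'I_N) h M : multiaffine h ->
  foldr (fun i w => w + c *: diffq i i w) h s M =
  h (M + c *: \sum_(i <- s) delta_mx i i).
Proof.
move=> hh; elim: s M => [|i s IH] M /=; first by rewrite big_nil scaler0 addr0.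
have ha := @multiaffine_prod _ (fun i => diffq i i) c s h (fun i g => @multiaffine_diffq i i g) hh.
by rewrite !fctE -ha IH big_cons scalerDr addrA.
Qed.

Lemma poly_eq_values (p q : {poly F}) : (forall x, p.[x] = q.[x]) -> p = q.
Proof.
move=> pq; apply/eqP; rewrite -subr_eq0; apply/eqP.
apply: (@roots_geq_poly_eq0 _ _ [seq n%:R | n <- iota 0 (size (p - q))]).
- by apply/allP => _ /mapP[n _ ->]; rewrite rootE !hornerE pq subrr.
- rewrite map_inj_uniq ?iota_uniq// => m n /eqP.
  by rewrite eqr_nat => /eqP.
- by rewrite size_map size_iota.
Qed.

Lemma shifted_detE z M : shifted_det z M = (char_poly M).[z].
Proof.
rewrite /shifted_det /char_poly -horner_evalE -det_map_mx; congr (\det _).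
by apply/matrixP => i j; rewrite !mxE /= horner_evalE !hornerE hornerMn hornerX.
Qed.

Section TraceDerivative.
Variables (z : F) (M : 'M[F]_N).
Local Notation h := (shifted_det z).

Let ha : multiaffine h. Proof. exact: multiaffine_shifted_det. Qed.
Let diffq_comm (i j : 'I_N) w : diffq i i (diffq j j w) = diffq j j (diffq i i w).
Proof. exact: diffqC. Qed.
Let diffq_sqr (i : 'I_N) : diffq i i (diffq i i h) = 0.
Proof. exact: diffq_sqr0. Qed.

(** Moving $z$ by $-c$ is the same as adding $c$ to every diagonal entry of [M]. *)
Lemma taylor_shifted_det c n : (N < n)%N ->
  (char_poly M).[z - c] = \sum_(k < n) (k`!%:R^-1 * c ^+ k) * iter k trdiff h M.
Proof.
move=> Nn.
have sz : (size (index_enum 'I_N) < n)%N by rewrite [index_enum _]unlock -enumT size_enum_ord.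
have := @prod_one_plus_nilpotent F W 'I_N (fun i => diffq i i) diffq_comm h diffq_sqr c _ n sz.
move=> /(congr1 (fun w : W => w M)).
rewrite diagonal_shift// -mx1_sum_delta -trdiffE => e.
rewrite -shifted_detE (_ : shifted_det (z - c) M = h (M + c *: 1%:M)).
  by rewrite e fct_sumE.
by rewrite /shifted_det scalemx1 raddfB /= opprD addrA addrAC.
Qed.

(** The expansion above is valid for two consecutive orders of truncation, and the
    last term is their difference. *)
Lemma iter_trdiff_large k : (N < k)%N -> iter k trdiff h M = 0.
Proof.
move=> Nk.
have := taylor_shifted_det 1 (leqW Nk).
rewrite big_ord_recr /= -(taylor_shifted_det 1 Nk) => /esym/eqP.
rewrite -subr_eq0 addrAC subrr add0r expr1n mulr1 mulf_eq0 invr_eq0 pnatr_eq0.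
by rewrite -leqn0 leqNgt fact_gt0 /= => /eqP.
Qed.

(** Two Taylor expansions of $c\mapsto\det(z+c-M)$ are compared: the one of the
    characteristic polynomial and the one along the diagonal. *)
Lemma derivn_char_poly k : (char_poly M)^`(k).[z] = (-1) ^+ k * iter k trdiff h M.
Proof.
have [Nk|kN] := ltnP N k.
  rewrite iter_trdiff_large// mulr0.
  by rewrite derivn_poly0 ?horner0// size_char_poly.
pose P := \poly_(k < N.+1) ((char_poly M)^`N(k).[z]).
pose Q := \poly_(k < N.+1) (k`!%:R^-1 * (-1) ^+ k * iter k trdiff h M).
have PQ : P = Q.
  apply: poly_eq_values => c.
  have := taylor_shifted_det (- c) (ltnSn N).
  rewrite opprK nderiv_taylor; last exact: mulrC.
  rewrite size_char_poly /P /Q !horner_poly => ->.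
  by apply: eq_bigr => j _; rewrite (exprNn c); ring.
move: PQ => /(congr1 (fun r : {poly F} => r`_k)).
rewrite !coef_poly ltnS kN => e.
rewrite nderivn_def hornerMn e -mulr_natr.
have fk : k`!%:R != 0 :> F by rewrite pnatr_eq0 -lt0n fact_gt0.
by field.
Qed.

Lemma iter_derivn2 (p : {poly F}) k : iter k (fun q : {poly F} => q^`(2)) p = p^`(k.*2).
Proof. by elim: k => //= k ->. Qed.

(** The signs of [derivn_char_poly] disappear because the orders are even. *)
Lemma horner_heat_char_poly (sigma : F) :
  (heat N sigma (char_poly M)).[z] =
  \sum_(k < N.+1) (k`!%:R^-1 * (sigma / (2 * N%:R)) ^+ k) * iter k.*2 trdiff h M.
Proof.
rewrite /heat size_char_poly horner_sum; apply: eq_bigr => k _.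
by rewrite hornerZ iter_derivn2 derivn_char_poly -signr_odd odd_double expr0 mul1r.
Qed.

(** This is the right-hand side of [horner_heat_char_poly] for
    $\sigma=-N\kappa$. *)
Lemma prod_mixdiff_shifted_det (kap : F) :
  foldr (fun b w => w + kap *: mixdiff b w) h upper_pairs M =
  \sum_(k < N.+1) (k`!%:R^-1 * (- kap / 2) ^+ k) * iter k.*2 trdiff h M.
Proof.
(* The exponential of the pairs is cut above their number, the sum in the
   statement above N; K is beyond both. *)
set K := (maxn N (size upper_pairs)).+1.
have sK : (size upper_pairs < K)%N by rewrite ltnS leq_maxr.
have := @prod_one_plus_nilpotent F W _ mixdiff (@mixdiffC) h
  (fun b => mixdiff_sqr0 b ha) kap _ K sK.
move=> /(congr1 (fun w : W => w M)) ->.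
have it k : iter k (opsum mixdiff upper_pairs) h = (- 2^-1) ^+ k *: iter k.*2 trdiff h.
  elim: k => [|k IH]; first by rewrite expr0 scale1r.
  rewrite iterS IH opsumZ exprSr -scalerA; congr (_ *: _).
  have cm1 g : opsum mixdiff upper_pairs (trdiff g) = trdiff (opsum mixdiff upper_pairs g).
    rewrite /opsum /trdiff; under eq_bigr do rewrite raddf_sum.
    rewrite exchange_big; apply: eq_bigr => i _.
    rewrite raddf_sum; apply: eq_bigr => b _.
    by rewrite /mixdiff /= !(diffqC i i).
  have cm l : opsum mixdiff upper_pairs (iter l trdiff h) =
      iter l trdiff (opsum mixdiff upper_pairs h).
    by elim: l => // l IHl; rewrite !iterS cm1 IHl.
  rewrite cm sum_upper_mixdiff doubleS !iterSr.
  have tZ c g : trdiff (c *: g) = c *: trdiff g by rewrite trdiffE opsumZ.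
  by elim: k.*2 => //= l ->; rewrite tZ.
rewrite fct_sumE.
rewrite (big_ord_widen K
  (fun k => (k`!%:R^-1 * (- kap / 2) ^+ k) * iter k.*2 trdiff h M)); last first.
  by rewrite ltnS leq_maxl.
rewrite [RHS]big_mkcond /=; apply: eq_bigr => k _; rewrite it !fctE /GRing.scale /=.
case: ifPn => [_|]; last first.
  rewrite -leqNgt => kN; rewrite iter_trdiff_large ?mulr0//.
  by rewrite -addnn ltn_addr.
by rewrite mulNr -mulrN exprMn; ring.
Qed.

End TraceDerivative.

End FiniteDifference.

(** * Measurable functions of a matrix *)

Section MeasurableMatrixFunctions.
Context (R : realType) (N : nat).
Local Notation C := R[i].
Implicit Types h : 'M[C]_N -> C^o.

Definition cmeas_mx d (T : measurableType d) (M : T -> 'M[C]_N) :=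
  forall i j, cmeas (fun w => M w i j).

(** Measurability of a function of matrices, in the form in which it is used and
    is stable under differences: composition with any random matrix. *)
Definition preserves_cmeas h := forall d (T : measurableType d) (M : T -> 'M[C]_N),
  cmeas_mx M -> cmeas (fun w => h (M w)).

Lemma cmeas_mxD d (T : measurableType d) (M1 M2 : T -> 'M[C]_N) :
  cmeas_mx M1 -> cmeas_mx M2 -> cmeas_mx (fun w => M1 w + M2 w).
Proof. by move=> m1 m2 i j; apply: cmeas_ext (cmeasD (m1 i j) (m2 i j)) => w; rewrite mxE. Qed.

Lemma cmeas_mx_comp d d' (T : measurableType d) (T' : measurableType d') (g : T' -> T)
    (M : T -> 'M[C]_N) : measurable_fun setT g -> cmeas_mx M -> cmeas_mx (fun w => M (g w)).
Proof.
move=> mg mM i j; have [m1 m2] := mM i j.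
by split; [exact: (measurableT_comp m1)|exact: (measurableT_comp m2)].
Qed.

Lemma preserves_cmeas_diffq i j h : preserves_cmeas h -> preserves_cmeas (diffq i j h).
Proof.
move=> mh d T M mM; apply: cmeasB; last exact: mh.
apply: mh => k l; under eq_fun do rewrite mxE.
by apply: cmeasD => //; exact: cmeas_cst.
Qed.

Lemma preserves_cmeas_prod_mixdiff (kap : C) (s : seq ('I_N * 'I_N)) h : preserves_cmeas h ->
  preserves_cmeas (foldr (fun b w => w + kap *: mixdiff b w) h s).
Proof.
move=> mh; elim: s => //= b s IH d T M mM.
apply: cmeasD; first exact: IH.
apply: cmeasM; first exact: cmeas_cst.
by apply: preserves_cmeas_diffq => //; exact: preserves_cmeas_diffq.
Qed.

Lemma preserves_cmeas_det z : preserves_cmeas (@shifted_det _ N z).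
Proof.
move=> d T M mM; rewrite /shifted_det /determinant.
apply: cmeas_sum => s; apply: cmeasM; first exact: cmeas_cst.
apply: cmeas_prod => i; under eq_fun do rewrite !mxE.
by apply: cmeasB => //; exact: cmeas_cst.
Qed.

End MeasurableMatrixFunctions.

(** * Changing the parameters of an elliptic matrix *)

Section EllipticBlocks.
Context (R : realType) (N : nat) (N_gt0 : (0 < N)%N).
Local Notation C := R[i].
Local Notation I := ('I_N * 'I_N)%type.
Local Notation K := (I + I)%type.
Local Notation V := (coord_space R K).

Definition gue_sd (k : I) : R :=
  Num.sqrt (if k.1 == k.2 then N%:R^-1 else (2 * N%:R)^-1).
(** The coordinates of two Hermitian matrices, one in each summand. *)
Definition pair_sd (k : K) : R := match k with inl k => gue_sd k | inr k => gue_sd k end.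

Lemma gue_sd_gt0 k : 0 < gue_sd k.
Proof. by rewrite sqrtr_gt0; case: ifP; rewrite invr_gt0 ?mulr_gt0 ?ltr0n. Qed.

Lemma pair_sd_gt0 k : 0 < pair_sd k.
Proof. by case: k => k; exact: gue_sd_gt0. Qed.

Context (m : probability V R).
Hypothesis m_law : product_law (fun k => normal_prob 0 (pair_sd k)) m.

(** The Hermitian matrix with given real coordinates, laid out as in
    [herm_coord]. *)
Definition herm_entry (x : I -> R) (i j : 'I_N) : C :=
  if (i < j)%N then x (i, j) +i* x (j, i)
  else if i == j then (x (i, i))%:C else x (j, i) +i* - x (i, j).

(** $(a,b,e)$ stands for the matrix $e(aX+ibY)$. *)
Definition param := (R * R * C)%type.

Definition ell_entry (p : param) (x : V) (i j : 'I_N) : C :=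
  p.2 * (p.1.1%:C * herm_entry (fun k => x (inl k)) i j +
         (0 +i* p.1.2) * herm_entry (fun k => x (inr k)) i j).

Definition block_of (i j : 'I_N) : I := if (i <= j)%N then (i, j) else (j, i).

(** Each block $\{(i,j),(j,i)\}$ has parameters of its own: the passage from one
    elliptic matrix to another goes through such hybrids. *)
Definition ell_mx (f : I -> param) (x : V) : 'M[C]_N :=
  \matrix_(i, j) ell_entry (f (block_of i j)) x i j.

Lemma cmeas_herm_entry (c : I -> K) i j : cmeas (fun x : V => herm_entry (fun k => x (c k)) i j).
Proof.
rewrite /herm_entry; case: (i < j)%N; last case: (i == j).
- by split; exact: measurable_coord.
- exact: cmeas_coord.
- by split; [exact: measurable_coord|apply: measurableT_comp => //; exact: measurable_coord].
Qed.

Lemma cmeas_ell_entry p i j : cmeas (fun x : V => ell_entry p x i j).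
Proof.
have m1 := cmeas_herm_entry inl i j; have m2 := cmeas_herm_entry inr i j.
by rewrite /ell_entry; solve_cmeas.
Qed.

Lemma cmeas_ell_mx f : cmeas_mx (ell_mx f).
Proof.
move=> i j; apply: cmeas_ext (cmeas_ell_entry (f (block_of i j)) i j) => x.
by rewrite mxE.
Qed.

Definition block_set (b : I) (i j : 'I_N) := ((i, j) == b) || ((j, i) == b).

(** The part of [A + ell_mx f x] that is independent of block [b]. *)
Definition off_block (A : 'M[C]_N) (f : I -> param) (b : I) (x : V) : 'M[C]_N :=
  \matrix_(i, j) (A i j + if block_set b i j then 0 else ell_entry (f (block_of i j)) x i j).

Lemma cmeas_off_block A f b : cmeas_mx (off_block A f b).
Proof.
move=> i j; pose e := block_set b i j.
apply: (@cmeas_ext _ _ _ (fun x => A i j + if e then 0 else ell_entry (f (block_of i j)) x i j)).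
  by move=> x; rewrite mxE.
apply: cmeasD; first exact: cmeas_cst.
by case: e; [exact: cmeas_cst|exact: cmeas_ell_entry].
Qed.

Lemma off_block_free A f b k : (k == inl b) || (k == inl (b.2, b.1)) ||
    (k == inr b) || (k == inr (b.2, b.1)) ->
  free_of k (off_block A f b).
Proof.
move=> kb x t; apply/matrixP => i j; rewrite !mxE; congr (_ + _).
case: ifPn => //; rewrite /block_set negb_or => /andP[h1 h2].
have h3 : (i, j) != (b.2, b.1).
  by apply: contraNN h2 => /eqP[-> ->]; case: (b).
have h4 : (j, i) != (b.2, b.1).
  by apply: contraNN h1 => /eqP[-> ->]; case: (b).
have ne q : (q == (i, j)) || (q == (j, i)) -> set_coord x k t (inl q) = x (inl q) /\
   set_coord x k t (inr q) = x (inr q).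
  move=> qq; have [q1 q2] : q != b /\ q != (b.2, b.1).
    by move/orP: qq => -[] /eqP ->.
  rewrite /set_coord; move: kb => /orP[/orP[/orP[]|]|] /eqP ->;
    by rewrite !(inj_eq inl_inj, inj_eq inr_inj) ?(negPf q1) ?(negPf q2).
have [e1 e2] : set_coord x k t (inl (i, j)) = x (inl (i, j)) /\
    set_coord x k t (inr (i, j)) = x (inr (i, j)).
  by apply: ne; rewrite eqxx.
have [e3 e4] : set_coord x k t (inl (j, i)) = x (inl (j, i)) /\
    set_coord x k t (inr (j, i)) = x (inr (j, i)).
  by apply: ne; rewrite eqxx orbT.
rewrite /ell_entry /herm_entry; case: ifP => _; first by rewrite e1 e2 e3 e4.
case: eqVneq => [ij|_]; last by rewrite e1 e2 e3 e4.
by move: e1 e2; rewrite -ij => -> ->.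
Qed.

(** The value in block $(i,j)$ is isolated as two rank-one terms, along which a
    multiaffine function can be expanded. *)
Lemma ell_mx_offdiag A f (i j : 'I_N) x : (i < j)%N ->
  A + ell_mx f x = off_block A f (i, j) x
    + ell_entry (f (i, j)) x i j *: delta_mx i j + ell_entry (f (i, j)) x j i *: delta_mx j i.
Proof.
move=> ij; apply/matrixP => k l; rewrite !mxE -!addrA; congr (_ + _).
rewrite /block_set /block_of !xpair_eqE.
have nij : i != j by apply: contraTneq ij => ->; rewrite ltnn.
have [->|ki] := eqVneq k i; have [->|li] := eqVneq l i => /=.
- by rewrite leqnn (negPf nij) !mulr0 !addr0.
- have [->|lj] := eqVneq l j; last by rewrite (negPf nij) !mulr0 !addr0.
  by rewrite (ltnW ij) mulr1 (negPf nij) mulr0 addr0 add0r.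
- have [->|kj] := eqVneq k j; last by rewrite !mulr0 !addr0.
  by rewrite leqNgt ij /= mulr1 mulr0 !add0r.
- by rewrite !andbF /= !mulr0 !addr0.
Qed.

Lemma ell_mx_diag A f (i : 'I_N) x :
  A + ell_mx f x = off_block A f (i, i) x + ell_entry (f (i, i)) x i i *: delta_mx i i.
Proof.
apply/matrixP => k l; rewrite !mxE -!addrA; congr (_ + _).
rewrite /block_set /block_of !xpair_eqE.
have [->|ki] := eqVneq k i; have [->|li] := eqVneq l i => /=.
- by rewrite leqnn mulr1 add0r.
- by rewrite mulr0 addr0.
- by rewrite mulr0 addr0.
- by rewrite mulr0 addr0.
Qed.

Lemma off_block_eq A f g (b : I) x : (forall c, c != b -> f c = g c) ->
  (b.1 <= b.2)%N -> off_block A f b x = off_block A g b x.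
Proof.
move=> fg b12; apply/matrixP => i j; rewrite !mxE; congr (_ + _).
case: ifPn => //; rewrite /block_set negb_or => /andP[h1 h2].
by rewrite fg// /block_of; case: ifP.
Qed.

Definition valid_param (s : R) (p : param) := sqn p.2 = 1 /\ p.1.1 ^+ 2 + p.1.2 ^+ 2 = s.
(** $E(Z_{ij}Z_{ji})$ for $i\ne j$. *)
Definition param_cov (p : param) : C :=
  (N%:R^-1)%:C * (p.2 ^+ 2 * (p.1.1 ^+ 2 - p.1.2 ^+ 2)%:C).

Lemma gue_sd_diag (i : 'I_N) : gue_sd (i, i) ^+ 2 = N%:R^-1.
Proof. by rewrite sqr_sqrtr /= eqxx ?invr_ge0. Qed.

Lemma gue_sd_offdiag (k : I) : k.1 != k.2 -> gue_sd k ^+ 2 *+ 2 = N%:R^-1.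
Proof.
move=> ij; rewrite sqr_sqrtr /= (negPf ij) ?invr_ge0 ?mulr_ge0//.
by rewrite -mulr_natl invfM mulrA mulfV ?mul1r.
Qed.

Lemma same_int_offdiag_ell (p : param) s (i j : 'I_N) (al be ga de : V -> C) : (i < j)%N ->
  valid_param s p ->
  cmeas al -> cmeas be -> cmeas ga -> cmeas de ->
  (forall k, (k == inl (i, j)) || (k == inl (j, i)) || (k == inr (i, j)) || (k == inr (j, i)) ->
    [/\ free_of k al, free_of k be, free_of k ga & free_of k de]) ->
  same_int m
    (fun x => sqn (al x + be x * ell_entry p x i j + ga x * ell_entry p x j i
       + de x * (ell_entry p x i j * ell_entry p x j i)))
    (fun x => sqn (al x + param_cov p * de x) + N%:R^-1 * s * sqn (be x)
       + N%:R^-1 * s * sqn (ga x) + (N%:R^-1 * s) ^+ 2 * sqn (de x)).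
Proof.
move=> ij [p1 ps] mal mbe mga mde fr.
have nij : i != j by apply: contraTneq ij => ->; rewrite ltnn.
have nji : j != i by rewrite eq_sym.
rewrite -ps.
have E1 x : ell_entry p x i j = p.2 * (p.1.1%:C * (x (inl (i, j)) +i* x (inl (j, i)))
   + (0 +i* p.1.2) * (x (inr (i, j)) +i* x (inr (j, i)))).
  by rewrite /ell_entry /herm_entry ij.
have E2 x : ell_entry p x j i = p.2 * (p.1.1%:C * ((x (inl (i, j)) +i* x (inl (j, i)))^*)%C
   + (0 +i* p.1.2) * ((x (inr (i, j)) +i* x (inr (j, i)))^*)%C).
  by rewrite /ell_entry /herm_entry ltnNge (ltnW ij) /= (negPf nji).
rewrite (_ : (fun x => sqn (_ + _ * (_ * _))) = fun x => sqn (al x +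
   be x * (p.2 * (p.1.1%:C * (x (inl (i, j)) +i* x (inl (j, i))) +
             (0 +i* p.1.2) * (x (inr (i, j)) +i* x (inr (j, i))))) +
   ga x * (p.2 * (p.1.1%:C * ((x (inl (i, j)) +i* x (inl (j, i)))^*)%C +
             (0 +i* p.1.2) * ((x (inr (i, j)) +i* x (inr (j, i)))^*)%C)) +
   de x * ((p.2 * (p.1.1%:C * (x (inl (i, j)) +i* x (inl (j, i))) +
             (0 +i* p.1.2) * (x (inr (i, j)) +i* x (inr (j, i))))) *
           (p.2 * (p.1.1%:C * ((x (inl (i, j)) +i* x (inl (j, i)))^*)%C +
             (0 +i* p.1.2) * ((x (inr (i, j)) +i* x (inr (j, i)))^*)%C))))); last first.
  by apply/funext => x; rewrite E1 E2.
apply: (same_int_offdiag_block pair_sd_gt0 m_law) => //.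
- by rewrite /= !inE !(inj_eq inl_inj, inj_eq inr_inj) /= !xpair_eqE (negPf nij) (negPf nji).
- move=> k; rewrite !inE => /or4P[] /eqP ->; exact: gue_sd_offdiag.
- by move=> k; rewrite !inE !orbA => /fr.
Qed.

Lemma same_int_diag_ell (p : param) s (i : 'I_N) (al be : V -> C) :
  valid_param s p -> cmeas al -> cmeas be ->
  (forall k, (k == inl (i, i)) || (k == inr (i, i)) -> free_of k al /\ free_of k be) ->
  same_int m (fun x => sqn (al x + be x * ell_entry p x i i))
    (fun x => sqn (al x) + N%:R^-1 * s * sqn (be x)).
Proof.
move=> [p1 <-] mal mbe fr.
have E1 x : ell_entry p x i i = p.2 * (p.1.1%:C * (x (inl (i, i)))%:C
   + (0 +i* p.1.2) * (x (inr (i, i)))%:C).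
  by rewrite /ell_entry /herm_entry ltnn eqxx.
rewrite (_ : (fun x => sqn (_ + _ * ell_entry _ _ _ _)) = fun x => sqn (al x +
   be x * (p.2 * (p.1.1%:C * (x (inl (i, i)))%:C
     + (0 +i* p.1.2) * (x (inr (i, i)))%:C)))); last first.
  by apply/funext => x; rewrite E1.
have [f1 f2] : free_of (inl (i, i)) al /\ free_of (inl (i, i)) be by apply: fr; rewrite eqxx.
have [f3 f4] : free_of (inr (i, i)) al /\ free_of (inr (i, i)) be by apply: fr; rewrite eqxx orbT.
by apply: (same_int_diag_block pair_sd_gt0 m_law) => //; exact: gue_sd_diag.
Qed.

Lemma addr_last_to_second (a b c d e : C) : a + b + c + d + e = a + e + b + c + d.
Proof. ring. Qed.

Lemma multiaffine2 (g : 'M[C]_N -> C^o) M i j (u v : C) : multiaffine g ->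
  g (M + u *: delta_mx i j + v *: delta_mx j i) =
  g M + diffq i j g M * u + diffq j i g M * v + mixdiff (i, j) g M * (u * v).
Proof.
move=> ga; have ga' := multiaffine_diffq j i ga.
by rewrite ga ga ga' /mixdiff /=; ring.
Qed.

(** A mixed difference is constant in the two entries that it differentiates. *)
Lemma mixdiff_invar (g : 'M[C]_N -> C^o) M i j (u v : C) : multiaffine g ->
  mixdiff (i, j) g (M + u *: delta_mx i j + v *: delta_mx j i) = mixdiff (i, j) g M.
Proof.
move=> ga; have gm : multiaffine (mixdiff (i, j) g) by do 2 apply: multiaffine_diffq.
have d1 : diffq i j (mixdiff (i, j) g) = 0.
  by rewrite diffq_sqr0//; exact: multiaffine_diffq.
have d2 : diffq j i (mixdiff (i, j) g) = 0.
  by rewrite /mixdiff /= (diffqC j i i j) diffq_sqr0// raddf0.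
by rewrite gm gm d1 d2 !mulr0 !addr0.
Qed.

Definition set_param (f : I -> param) b p : I -> param := fun c => if c == b then p else f c.

(** By [same_int_offdiag_ell] the average over block [b] of a function with
    coefficients $\alpha,\beta,\gamma,\delta$ depends on the parameters only
    through $\alpha+c\delta$, and $\delta$ is the mixed difference; a change of $c$
    is undone by adding a multiple of $\delta$ to $\alpha$.  In a diagonal block
    the average is the same for both parameters and the mixed difference is
    zero. *)
Lemma same_int_block A f (b : I) p0 p1 s (g : 'M[C]_N -> C^o) :
  (b.1 <= b.2)%N -> f b = p1 -> valid_param s p1 -> valid_param s p0 ->
  multiaffine g -> preserves_cmeas g ->
  same_int m (fun x => sqn (g (A + ell_mx f x)))
   (fun x => sqn ((g + (param_cov p1 - param_cov p0) *: mixdiff b g)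
                  (A + ell_mx (set_param f b p0) x))).
Proof.
move=> b12 fb vp1 vp0 ga mg.
set kap := param_cov p1 - param_cov p0.
have oE x : off_block A (set_param f b p0) b x = off_block A f b x.
  by apply: off_block_eq => // c cb; rewrite /set_param (negPf cb).
case: b b12 fb oE => i j /=; rewrite leq_eqVlt => /orP[/eqP/val_inj <- fb oE|ij fb oE].
  pose al x := g (off_block A f (i, i) x).
  pose be x := diffq i i g (off_block A f (i, i) x).
  have mal : cmeas al by apply: mg; exact: cmeas_off_block.
  have mbe : cmeas be by apply: (preserves_cmeas_diffq i i mg); exact: cmeas_off_block.
  have fr k : (k == inl (i, i)) || (k == inr (i, i)) -> free_of k al /\ free_of k be.
    move=> hk; have of_ := @off_block_free A f (i, i) k.
    by split => x t; rewrite /al /be of_//=; case/orP: hk => ->; rewrite ?orbT.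
  have S p : valid_param s p -> same_int m (fun x => sqn (al x + be x * ell_entry p x i i))
    (fun x => sqn (al x) + N%:R^-1 * s * sqn (be x)).
    by move=> vp; exact: same_int_diag_ell.
  have [n1 n2 e1] := S _ vp1; have [n3 _ e3] := S _ vp0.
  rewrite (_ : (fun x => sqn (g _)) =
    (fun x => sqn (al x + be x * ell_entry p1 x i i))); last first.
    by apply/funext => x; rewrite (ell_mx_diag A f i x) ga fb mulrC.
  rewrite (_ : (fun x => sqn ((g + _) _)) =
    (fun x => sqn (al x + be x * ell_entry p0 x i i))); last first.
    apply/funext => x; rewrite mixdiff_diag// scaler0 addr0.
    by rewrite (ell_mx_diag A _ i x) oE ga /set_param eqxx mulrC.
  by split => //; rewrite e1 e3.
pose O x := off_block A f (i, j) x.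
pose al x := g (O x).
pose be x := diffq i j g (O x).
pose ga' x := diffq j i g (O x).
pose de x := mixdiff (i, j) g (O x).
have mO : cmeas_mx O by exact: cmeas_off_block.
have mal : cmeas al by exact: mg.
have mbe : cmeas be by exact: (preserves_cmeas_diffq i j mg).
have mga : cmeas ga' by exact: (preserves_cmeas_diffq j i mg).
have mde : cmeas de.
  by have := preserves_cmeas_diffq i j (preserves_cmeas_diffq j i mg); apply.
have fr k : (k == inl (i, j)) || (k == inl (j, i)) || (k == inr (i, j)) || (k == inr (j, i)) ->
    [/\ free_of k al, free_of k be, free_of k ga' & free_of k de].
  move=> hk; have of_ := @off_block_free A f (i, j) k hk.
  by split => x t; rewrite /al /be /ga' /de /O of_.
pose al' x := al x + kap * de x.
have mal' : cmeas al' by rewrite /al'; solve_cmeas.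
have fr' k : (k == inl (i, j)) || (k == inl (j, i)) || (k == inr (i, j)) || (k == inr (j, i)) ->
    [/\ free_of k al', free_of k be, free_of k ga' & free_of k de].
  by move=> /fr[f1 f2 f3 f4]; split => // x t; rewrite /al' f1 f4.
have [n1 n2 e1] := same_int_offdiag_ell ij vp1 mal mbe mga mde fr.
have [n3 _ e3] := same_int_offdiag_ell ij vp0 mal' mbe mga mde fr'.
rewrite (_ : (fun x => sqn (g _)) = (fun x => sqn (al x + be x * ell_entry p1 x i j +
   ga' x * ell_entry p1 x j i + de x * (ell_entry p1 x i j * ell_entry p1 x j i)))); last first.
  by apply/funext => x; rewrite (ell_mx_offdiag _ _ _ ij) multiaffine2// fb.
rewrite (_ : (fun x => sqn ((g + _) _)) = (fun x => sqn (al' x + be x * ell_entry p0 x i j +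
   ga' x * ell_entry p0 x j i + de x * (ell_entry p0 x i j * ell_entry p0 x j i)))); last first.
  apply/funext => x; rewrite (ell_mx_offdiag _ _ _ ij) oE !fctE multiaffine2// mixdiff_invar//.
  by rewrite /set_param eqxx /al' /GRing.scale /=; congr sqn; exact: (addr_last_to_second (al x)).
split => //; rewrite e1 e3; apply: eq_integral => x _; congr (_%:E).
by congr (sqn _ + _ + _ + _); rewrite /al' /kap; ring.
Qed.

(** The blocks are exchanged one at a time; the function obtained after each
    exchange is again multiaffine, so that [same_int_block] applies to it. *)
Lemma same_int_all_blocks A p0 p1 s (g : 'M[C]_N -> C^o) :
  valid_param s p1 -> valid_param s p0 -> multiaffine g -> preserves_cmeas g ->
  same_int m (fun x => sqn (g (A + ell_mx (fun=> p1) x)))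
   (fun x => sqn (foldr (fun b w => w + (param_cov p1 - param_cov p0) *: mixdiff b w) g
                        (upper_pairs N) (A + ell_mx (fun=> p0) x))).
Proof.
move=> vp1 vp0 ga mg; set kap := param_cov p1 - param_cov p0.
(* The hybrid in which the blocks of L have already been exchanged. *)
pose f (L : seq I) : I -> param := fun b => if b \in L then p0 else p1.
have -> : ell_mx (fun=> p0) = ell_mx (f (upper_pairs N)).
  apply/funext => x; apply/matrixP => i j; rewrite !mxE /f.
  rewrite mem_filter mem_enum andbT /block_of.
  by case: (leqP i j) => h /=; rewrite ?h// (ltnW h).
have uU : uniq (upper_pairs N) by rewrite filter_uniq// enum_uniq.
have : all (fun b : I => b.1 <= b.2)%N (upper_pairs N) by exact: filter_all.
elim: (upper_pairs N) uU => [_ _|b L IH /= /andP[bL uL] /andP[b12 aL]].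
  have -> : (fun=> p1) = f [::] by apply/funext.
  apply: same_int_refl; apply: nnmeas_sqn; apply: mg => i j.
  apply: cmeas_ext (cmeasD (cmeas_cst _ (A i j)) (@cmeas_ell_mx (f [::]) i j)) => x.
  by rewrite [RHS]mxE.
apply: (same_int_trans (IH uL aL)).
have -> : f (b :: L) = set_param (f L) b p0.
  by apply/funext => c; rewrite /f /set_param inE; case: eqVneq.
apply: (@same_int_block A (f L) b p0 p1 s) => //.
- by rewrite /f (negPf bL).
- apply: multiaffine_prod => // k h hh.
  by do 2 apply: multiaffine_diffq.
- exact: preserves_cmeas_prod_mixdiff.
Qed.

Lemma param_cov_heat s p0 p1 A z : valid_param s p1 -> valid_param s p0 ->
  same_int m (fun x => sqn (\det (z%:M - (A + ell_mx (fun=> p1) x))))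
   (fun x => sqn (heat N (N%:R * (param_cov p0 - param_cov p1))
                       (char_poly (A + ell_mx (fun=> p0) x))).[z]).
Proof.
move=> vp1 vp0.
have := same_int_all_blocks A vp1 vp0 (@multiaffine_shifted_det _ _ z) (@preserves_cmeas_det _ _ z).
rewrite /shifted_det.
congr same_int; apply/funext => x; congr sqn.
rewrite prod_mixdiff_shifted_det horner_heat_char_poly; apply: eq_bigr => k _; congr (_ * _ * _).
congr (_ ^+ _).
have N0 : N%:R != 0 :> C by rewrite pnatr_eq0 -lt0n.
by field.
Qed.

End EllipticBlocks.

(** * Independent random matrices *)

HB.instance Definition _ (R : realType) := isPointed.Build R[i] 0.

Section MatrixSpace.
Context (R : realType) (N : nat).

Definition mx_cylinders : set (set 'M[R[i]]_N) :=
  [set C | exists (i j : 'I_N) (B : set R), measurable B /\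
        (C = [set A : 'M[R[i]]_N | B (complex.Re (A i j))] \/
         C = [set A : 'M[R[i]]_N | B (complex.Im (A i j))])].

(** Matrices with the Borel sigma-algebra of [mx_borel], as a type on which measures
    and product measures are available. *)
Definition mx_space := g_sigma_algebraType mx_cylinders.
HB.instance Definition _ := Measurable.on mx_space.

Lemma mx_borelE (A : set 'M[R[i]]_N) : mx_borel A = measurable (A : set mx_space).
Proof. by []. Qed.

Lemma cmeas_mx_id : cmeas_mx (fun A : mx_space => A : 'M[R[i]]_N).
Proof.
move=> i j; split=> _ B mB; rewrite setTI; apply: sub_sigma_algebra;
  exists i, j, B; split => //; by [left|right].
Qed.

Lemma measurable_to_mx d (T : measurableType d) (X : T -> 'M[R[i]]_N) :
  random_mx X -> measurable_fun setT (X : T -> mx_space).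
Proof.
move=> mX; apply: (measurability (mx_cylinders : set (set mx_space))) => //.
move=> _ [C [i [j [B [mB BE]]]] <-].
have [m1 m2] := mX i j.
by case: BE => ->; [exact: m1|exact: m2].
Qed.

End MatrixSpace.

Section IndependentMatrices.
Context d (T : measurableType d) (R : realType) (P : probability T R) (N : nat).
Implicit Types X Y Z : T -> 'M[R[i]]_N.

(** Independence says that the joint law is the product of the two laws. *)
Lemma integral_indep_mx X Z (h : mx_space R N * mx_space R N -> \bar R) :
  random_mx X -> random_mx Z -> indep_mx P X Z ->
  measurable_fun setT h -> (forall x, 0 <= h x)%E ->
  (\int[P]_w h (X w, Z w) =
   \int[pushforward P (X : T -> mx_space R N)]_A \int[P]_w h (A, Z w))%E.
Proof.
move=> rX rZ iXZ mh h0.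
have mX := measurable_to_mx rX; have mZ := measurable_to_mx rZ.
pose Xm : {mfun T >-> mx_space R N} :=
  HB.pack (X : T -> mx_space R N) (isMeasurableFun.Build _ _ _ _ _ mX).
pose Zm : {mfun T >-> mx_space R N} :=
  HB.pack (Z : T -> mx_space R N) (isMeasurableFun.Build _ _ _ _ _ mZ).
pose XZ w : mx_space R N * mx_space R N := (X w, Z w).
have mXZ : measurable_fun setT XZ by exact: measurable_fun_pair.
transitivity (\int[pushforward P XZ]_p h p)%E.
  by rewrite ge0_integral_pushforward.
transitivity (\int[(distribution P Xm) \x (distribution P Zm)]_p h p)%E.
  apply: eq_measure_integral => A mA _; symmetry.
  exact: product_measure_unique.
rewrite fubini_tonelli1//.
apply: eq_integral => A _; rewrite /fubini_F ge0_integral_pushforward//.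
by apply: measurableT_comp => //; exact: measurable_pair1.
Qed.

End IndependentMatrices.

(** * Traces of products of Hermitian matrices *)

Section HermitianTraces.
Context (R : realType) (N : nat).
Local Notation I := ('I_N * 'I_N)%type.
Implicit Types x y : I -> R.

Definition herm_mx x : 'M[R[i]]_N := \matrix_(i, j) herm_entry x i j.

(** Off the diagonal each coordinate contributes to the two entries in opposite
    positions. *)
Definition herm_inner x y : R :=
  \sum_(k : I) (if k.1 == k.2 then 1 else 2) * (x k * y k).

Lemma herm_innerC x y : herm_inner x y = herm_inner y x.
Proof. by apply: eq_bigr => k _; rewrite (mulrC (x k)). Qed.

(** The terms of positions $(i,j)$ and $(j,i)$ only match together, whence the
    doubling of both sums. *)
Lemma tr_herm_mul x y : \tr (herm_mx x *m herm_mx y) = (herm_inner x y)%:C.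
Proof.
pose G i j := herm_entry x i j * herm_entry y j i.
pose Wt (i j : 'I_N) : R[i] := ((if i == j then 1 else 2) * (x (i, j) * y (i, j)))%:C.
have -> : \tr (herm_mx x *m herm_mx y) = \sum_i \sum_j G i j.
  by apply: eq_bigr => i _; rewrite mxE; apply: eq_bigr => j _; rewrite !mxE.
have -> : (herm_inner x y)%:C = \sum_i \sum_j Wt i j.
  by rewrite rmorph_sum /= pair_big /=; apply: eq_bigr => -[i j] _.
have GW i j : G i j + G j i = Wt i j + Wt j i.
  rewrite /G /Wt /herm_entry; case: (ltngtP i j) => [ij|ji|/val_inj <-].
  - have ne : i != j by apply: contraTneq ij => ->; rewrite ltnn.
    have ne' := ne; rewrite eq_sym in ne'.
    rewrite (negPf ne) (negPf ne').
    by apply/eqP; rewrite eq_complex /=; apply/andP; split; apply/eqP; ring.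
  - have ne : i != j by apply: contraTneq ji => ->; rewrite ltnn.
    have ne' := ne; rewrite eq_sym in ne'.
    rewrite (negPf ne) (negPf ne').
    by apply/eqP; rewrite eq_complex /=; apply/andP; split; apply/eqP; ring.
  - rewrite eqxx.
    by apply/eqP; rewrite eq_complex /=; apply/andP; split; apply/eqP; ring.
have two (H : 'I_N -> 'I_N -> R[i]) : 2 * (\sum_i \sum_j H i j) = \sum_i \sum_j (H i j + H j i).
  rewrite mulr_natl mulr2n {2}exchange_big /= -big_split /=.
  by apply: eq_bigr => i _; rewrite -big_split.
have n2 : 2 != 0 :> R[i] by rewrite pnatr_eq0.
apply: (mulfI n2); rewrite !two.
by apply: eq_bigr => i _; apply: eq_bigr => j _.
Qed.

Lemma adjmx_herm x : adjmx (herm_mx x) = herm_mx x.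
Proof.
apply/matrixP => i j; rewrite !mxE /herm_entry.
case: (ltngtP i j) => [ij|ji|/val_inj <-].
- have ne : j != i by apply: contraTneq ij => ->; rewrite ltnn.
  by rewrite (negPf ne) /= opprK.
- have ne : i != j by apply: contraTneq ji => ->; rewrite ltnn.
  by rewrite (negPf ne).
- by rewrite eqxx /= oppr0.
Qed.

Lemma adjmxD (A B : 'M[R[i]]_N) : adjmx (A + B) = adjmx A + adjmx B.
Proof. by rewrite /adjmx map_mxD linearD. Qed.

Lemma adjmxZ c (A : 'M[R[i]]_N) : adjmx (c *: A) = c^*%C *: adjmx A.
Proof. by rewrite /adjmx map_mxZ linearZ. Qed.

Lemma mxtrace_mul_lin (F : comNzRingType) n (X Y : 'M[F]_n) c1 c2 c3 c4 :
  \tr ((c1 *: X + c2 *: Y) *m (c3 *: X + c4 *: Y)) =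
  c1 * c3 * \tr (X *m X) + c1 * c4 * \tr (X *m Y) +
  c2 * c3 * \tr (Y *m X) + c2 * c4 * \tr (Y *m Y).
Proof.
rewrite mulmxDl !mulmxDr -!scalemxAl -!scalemxAr !scalerA !mxtraceD !mxtraceZ.
by rewrite !addrA.
Qed.

Variables (x y : I -> R) (a b : R) (e : R[i]).
Let Z : 'M[R[i]]_N := e *: (a%:C *: herm_mx x + (0 +i* b) *: herm_mx y).

Lemma tr_ell_adj : sqn e = 1 -> \tr (adjmx Z *m Z) =
  (a ^+ 2 * herm_inner x x + b ^+ 2 * herm_inner y y)%:C.
Proof.
move=> e1; rewrite /Z adjmxZ adjmxD !adjmxZ !adjmx_herm.
rewrite -scalemxAl -scalemxAr scalerA mxtraceZ mxtrace_mul_lin !tr_herm_mul (herm_innerC y x).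
have -> : e^*%C * e = (sqn e)%:C.
  rewrite /sqn; case: e => r s; apply/eqP; rewrite eq_complex /=.
  by apply/andP; split; apply/eqP; ring.
rewrite e1 mul1r; apply/eqP; rewrite eq_complex /=; apply/andP; split; apply/eqP; ring.
Qed.

Lemma tr_ell_sqr : \tr (Z *m Z) =
  e ^+ 2 * ((a ^+ 2 * herm_inner x x - b ^+ 2 * herm_inner y y) +i* (2 * (a * b) * herm_inner x y)).
Proof.
rewrite /Z -scalemxAl -scalemxAr scalerA mxtraceZ mxtrace_mul_lin !tr_herm_mul.
rewrite (herm_innerC y x) -expr2; congr (_ * _).
apply/eqP; rewrite eq_complex /=; apply/andP; split; apply/eqP; ring.
Qed.

End HermitianTraces.

(** * The coordinates of a pair of independent GUE matrices *)

Lemma measurable_herm_coord d (T : measurableType d) (R : realType) (N : nat)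
    (Z : T -> 'M[R[i]]_N) k : random_mx Z -> measurable_fun setT (herm_coord Z k).
Proof.
move=> rZ; rewrite /herm_coord; case: (k.1 <= k.2)%N.
  by have [] := rZ k.1 k.2.
by have [] := rZ k.2 k.1.
Qed.

Section GUECoordinates.
Context d (T : measurableType d) (R : realType) (P : probability T R) (N : nat).
Local Notation I := ('I_N * 'I_N)%type.
Local Notation V := (coord_space R (I + I)%type).
Local Notation mx_coord := (herm_coord (fun M : mx_space R N => M : 'M[R[i]]_N)).
Variables (X Y : T -> 'M[R[i]]_N).
Hypotheses (gX : GUE P X) (gY : GUE P Y) (iXY : indep_mx P X Y).

Definition gue_coords (w : T) : V :=
  fun k => match k with inl k => herm_coord X k w | inr k => herm_coord Y k w end.

Lemma measurable_gue_coords : measurable_fun setT gue_coords.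
Proof.
apply: measurable_to_coord => -[] k /=; apply: measurable_herm_coord.
  by case: gX.
by case: gY.
Qed.

Lemma mx_borel_herm_box (B : I -> set R) : (forall k, measurable (B k)) ->
  mx_borel [set M : 'M[R[i]]_N | forall k, B k (mx_coord k M)].
Proof.
move=> mB; rewrite mx_borelE.
rewrite (_ : [set M | _] = \bigcap_(k in setT)
  ((fun M => mx_coord k M) @^-1` B k)).
  apply: fin_bigcap_measurable => // k _.
  rewrite -[X in measurable X]setTI.
  apply: measurable_herm_coord => //; exact: cmeas_mx_id.
by apply/seteqP; split => M /= h k => [_|]; apply: h.
Qed.

Lemma gue_herm_box (Z : T -> 'M[R[i]]_N) (B : I -> set R) : GUE P Z ->
  (forall k, measurable (B k)) ->
  P (Z @^-1` [set M : 'M[R[i]]_N | forall k, B k (mx_coord k M)]) =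
  (\prod_k normal_prob 0 (gue_sd R k) (B k))%E.
Proof.
move=> [_ _ iZ nZ] mB.
rewrite (_ : _ @^-1` _ = \bigcap_(k in setT) (herm_coord Z k @^-1` B k)).
  by rewrite iZ//; apply: eq_bigr => k _; exact: nZ.
by apply/seteqP; split => w /= h k => [_|]; apply: h.
Qed.

(** Independence of [X] and [Y] as matrices, together with the independence of the
    coordinates of each, makes all the coordinates independent. *)
Lemma gue_coords_box (B : (I + I)%type -> set R) : (forall k, measurable (B k)) ->
  pushforward P gue_coords [set x : (I + I)%type -> R | forall k, B k (x k)] =
  (\prod_k normal_prob 0 (pair_sd R k) (B k))%E.
Proof.
move=> mB; rewrite big_sumType /=.
rewrite -(gue_herm_box gX)// -(gue_herm_box gY)// -iXY;
  [|exact: (@mx_borel_herm_box (fun k => B (inl k)))|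
    exact: (@mx_borel_herm_box (fun k => B (inr k)))].
congr (P _); apply/seteqP; split => w /= => [h|[h1 h2] []//].
by split => k; [exact: (h (inl k))|exact: (h (inr k))].
Qed.

Lemma herm_entryE (Z : T -> 'M[R[i]]_N) w i j : (forall w, adjmx (Z w) = Z w) ->
  Z w i j = herm_entry (fun k => herm_coord Z k w) i j.
Proof.
move=> hZ.
have c k l : Z w k l = (Z w l k)^*%C by rewrite -{1}hZ !mxE.
rewrite /herm_entry /herm_coord /=.
case: ltnP => [ij|ji]; first by rewrite (ltnW ij) /=; case: (Z w i j).
case: eqVneq => [->|nij].
  rewrite leqnn; have := c j j; case: (Z w j j) => a b [] /eqP.
  by rewrite -subr_eq0 opprK -mulr2n mulrn_eq0 /= => /eqP ->.
have lt : (j < i)%N by rewrite ltn_neqAle eq_sym nij.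
by rewrite leqNgt lt /= c; case: (Z w j i).
Qed.

Lemma elliptic_coords (a b : R) (e : R[i]) w :
  e *: (a%:C *: X w + (0 +i* b) *: Y w) = ell_mx (fun=> (a, b, e)) (gue_coords w).
Proof.
apply/matrixP => i j; rewrite !mxE /ell_entry /=.
by congr (_ * (_ * _ + _ * _)); apply: herm_entryE; [case: gX|case: gY].
Qed.

Lemma elliptic_herm (a b : R) (e : R[i]) w :
  e *: (a%:C *: X w + (0 +i* b) *: Y w) =
  e *: (a%:C *: herm_mx (fun k => gue_coords w (inl k))
        + (0 +i* b) *: herm_mx (fun k => gue_coords w (inr k))).
Proof.
congr (_ *: (_ *: _ + _ *: _)); apply/matrixP => i j; rewrite mxE.
  by apply: herm_entryE; case: gX.
by apply: herm_entryE; case: gY.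
Qed.

End GUECoordinates.

(** * First and second moments *)

Section HasMean.
Context d (T : measurableType d) (R : realType) (P : probability T R).
Implicit Types (f g : T -> R).

(** Integrability is part of the notion so that means are linear. *)
Definition has_mean f (c : R) :=
  P.-integrable setT (EFin \o f) /\ (\int[P]_w (f w)%:E = c%:E)%E.

Lemma has_meanD f g a b : has_mean f a -> has_mean g b ->
  has_mean (fun w => f w + g w) (a + b).
Proof.
move=> [fi fE] [gi gE]; split; first by have := integrableD measurableT fi gi.
under eq_integral do rewrite EFinD.
by rewrite integralD// fE gE.
Qed.

Lemma has_meanZ f a c : has_mean f a -> has_mean (fun w => c * f w) (c * a).
Proof.
move=> [fi fE]; split; first by have := integrableZl measurableT c fi.
under eq_integral do rewrite EFinM.
by rewrite integralZl// fE.
Qed.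

Lemma has_mean_cst c : has_mean (fun=> c) c.
Proof.
split; first exact: finite_measure_integrable_cst.
by rewrite integral_cst// [X in (_ * X)%E]probability_setT mule1.
Qed.

Lemma has_mean_sum (J : Type) (s : seq J) (F : J -> T -> R) (a : J -> R) :
  (forall j, has_mean (F j) (a j)) ->
  has_mean (fun w => \sum_(j <- s) F j w) (\sum_(j <- s) a j).
Proof.
move=> h; elim: s => [|j s IH].
  by rewrite big_nil; under eq_fun do rewrite big_nil; exact: has_mean_cst.
by rewrite big_cons; under eq_fun do rewrite big_cons; exact: has_meanD.
Qed.

Lemma has_mean_ge0 f c : measurable_fun setT f -> (forall w, 0 <= f w) ->
  (\int[P]_w (f w)%:E = c%:E)%E -> has_mean f c.
Proof.
move=> mf f0 fE; split => //; apply/integrableP; split; first exact/measurable_EFinP.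
by under eq_integral do rewrite /= ger0_norm//; rewrite fE ltry.
Qed.

Lemma has_mean_eq f g a b : has_mean f a -> f =1 g -> a = b -> has_mean g b.
Proof. by move=> h fg <-; have <- : f = g by apply/funext. Qed.

Lemma has_mean_expect f c : has_mean f c -> fine ('E_P[f]) = c.
Proof. by move=> [_ h]; rewrite unlock h. Qed.

End HasMean.

Lemma nnmeas_integral_pushforward d d' (T : measurableType d) (T' : measurableType d')
    (R : realType) (P : {measure set T -> \bar R}) (m : {measure set T' -> \bar R})
    (f : T -> T') (phi : T' -> R) :
  measurable_fun setT f -> (forall A, measurable A -> m A = pushforward P f A) ->
  nnmeas phi -> (\int[m]_x (phi x)%:E = \int[P]_w (phi (f w))%:E)%E.
Proof.
move=> mf mE [mphi phi0].
rewrite (eq_measure_integral (pushforward P f)); last by move=> A mA _; exact: mE.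
rewrite ge0_integral_pushforward//; first exact/measurable_EFinP.
by move=> x _; rewrite lee_fin.
Qed.

Lemma has_mean_pushforward d d' (T : measurableType d) (T' : measurableType d') (R : realType)
    (P : probability T R) (m : probability T' R) (f : T -> T') (phi : T' -> R) c :
  measurable_fun setT f -> (forall A, measurable A -> m A = pushforward P f A) ->
  measurable_fun setT phi -> has_mean m phi c -> has_mean P (fun w => phi (f w)) c.
Proof.
move=> mf mE mphi [phi_int phiE].
have mE' (g : T' -> \bar R) : (\int[m]_x g x = \int[pushforward P f]_x g x)%E.
  by apply: eq_measure_integral => A mA _; exact: mE.
have mphi' : measurable_fun setT (EFin \o phi) by exact/measurable_EFinP.
have Pi : P.-integrable setT (EFin \o phi \o f).
  apply/integrableP; split; first exact: measurableT_comp.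
  move/integrableP : phi_int => [_]; rewrite mE' ge0_integral_pushforward//.
  by apply: measurableT_comp.
split => //; rewrite -phiE mE' integral_pushforward//.
Qed.

Section GaussianSecondMoments.
Context (R : realType) (K : finType).
Local Notation V := (coord_space R K).
Context (m : probability V R) (sigma : K -> R) (sigma_gt0 : forall k, 0 < sigma k).
Hypothesis m_law : product_law (fun k => normal_prob 0 (sigma k)) m.

Lemma mean_sqr k : has_mean m (fun x => x k ^+ 2) (sigma k ^+ 2).
Proof.
apply: has_mean_ge0; first by apply: measurable_funX; exact: measurable_coord.
  by move=> x; exact: sqr_ge0.
have [_ _] := @same_int_gaussian_coord _ _ m sigma sigma_gt0 m_law k (fun=> 0) (fun=> 1) (fun=> 0)
  (cmeas_cst _ _) (cmeas_cst _ _) (cmeas_cst _ _)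
  (fun _ _ => erefl) (fun _ _ => erefl) (fun _ _ => erefl).
under eq_integral do rewrite mul1r mul0r add0r addr0 sqn_real.
move=> ->; under eq_integral do rewrite mulr0 addr0 sqn0 mulr0 addr0 add0r sqn_real expr1n mulr1.
by have [_ ->] := has_mean_cst m (sigma k ^+ 2).
Qed.

(** By polarization, from the second moments of the two coordinates and of their
    sum. *)
Lemma mean_prod k l : has_mean m (fun x => x k * x l) (if k == l then sigma k ^+ 2 else 0).
Proof.
have [<-|kl] := eqVneq k l; first exact: mean_sqr.
suff S : has_mean m (fun x => (x k + x l) ^+ 2) (sigma k ^+ 2 + sigma l ^+ 2).
  by apply: has_mean_eq (has_meanZ 2^-1 (has_meanD S (has_meanD (has_meanZ (-1) (mean_sqr k))
    (has_meanZ (-1) (mean_sqr l))))) _ _ => [x|]; field.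
apply: has_mean_ge0.
- by apply: measurable_funX; apply: measurable_funD; exact: measurable_coord.
- by move=> x; exact: sqr_ge0.
have fl : free_of k (fun x : V => (x l)%:C) by move=> x t; rewrite /set_coord eq_sym (negPf kl).
have [_ _] := @same_int_gaussian_coord _ _ m sigma sigma_gt0 m_law k
  (fun x => (x l)%:C) (fun=> 1) (fun=> 0)
  (cmeas_coord _ l) (cmeas_cst _ _) (cmeas_cst _ _) fl (fun _ _ => erefl) (fun _ _ => erefl).
under eq_integral do rewrite mul1r mul0r addr0 -rmorphD sqn_real addrC.
move=> ->.
have [_ <-] := has_meanD (has_mean_cst m (sigma k ^+ 2)) (mean_sqr l).
apply: eq_integral => x _; congr EFin.
by rewrite mulr0 addr0 sqn0 mulr0 addr0 !sqn_real expr1n mulr1 addrC.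
Qed.

End GaussianSecondMoments.

(** * The parameters of an elliptic matrix *)

Section EllipticParameters.
Context d (T : measurableType d) (R : realType) (P : probability T R) (N : nat).
Hypothesis N_gt0 : (0 < N)%N.
Local Notation I := ('I_N * 'I_N)%type.
Local Notation V := (coord_space R (I + I)%type).

Section Means.
Context (m : probability V R).
Hypothesis m_law : product_law (fun k => normal_prob 0 (pair_sd R k)) m.

Lemma mean_herm_inner (c1 c2 : I -> I + I) :
  (forall k, pair_sd R (c1 k) = gue_sd R k) ->
  has_mean m (fun x => herm_inner (fun k => x (c1 k)) (fun k => x (c2 k)))
     (\sum_(k : I) (if k.1 == k.2 then 1 else 2) * (if c1 k == c2 k then gue_sd R k ^+ 2 else 0)).
Proof.
move=> c1E; apply: has_mean_sum => k; apply: has_meanZ.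
by rewrite -c1E; exact: (mean_prod (pair_sd_gt0 R N_gt0) m_law).
Qed.

(** The weights of [herm_inner] compensate the smaller variance of the coordinates
    off the diagonal. *)
Lemma weighted_gue_var (k : I) : (if k.1 == k.2 then 1 else 2) * gue_sd R k ^+ 2 = N%:R^-1 :> R.
Proof.
case: k => i j /=; case: eqVneq => [<-|ij]; first by rewrite mul1r gue_sd_diag.
by rewrite mulr_natl gue_sd_offdiag.
Qed.

Lemma mean_herm_inner_same (c : I -> I + I) : (forall k, pair_sd R (c k) = gue_sd R k) ->
  has_mean m (fun x => herm_inner (fun k => x (c k)) (fun k => x (c k))) N%:R.
Proof.
move=> cE; apply: has_mean_eq (mean_herm_inner c cE) (fun=> erefl) _.
under eq_bigr do rewrite eqxx weighted_gue_var.
rewrite sumr_const (_ : #|_| = (N * N)%N); last by rewrite card_prod card_ord.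
rewrite -(mulr_natr _ (N * N)) natrM mulKf//.
by rewrite pnatr_eq0 -lt0n.
Qed.

Lemma mean_herm_inner_cross :
  has_mean m (fun x => herm_inner (fun k => x (inl k)) (fun k => x (inr k))) 0.
Proof.
apply: has_mean_eq (mean_herm_inner inr _) (fun=> erefl) _ => //.
by rewrite big1// => k _; rewrite mulr0.
Qed.

Lemma measurable_herm_inner (c1 c2 : I -> I + I) :
  measurable_fun setT (fun x : V => herm_inner (fun k => x (c1 k)) (fun k => x (c2 k))).
Proof.
apply: measurable_sum => k; apply: measurable_funM => //.
by apply: measurable_funM; exact: measurable_coord.
Qed.
End Means.

(** The definition of an elliptic matrix gives $s$ and $\tau$ as expected traces.
    Since $E\,\mathrm{tr}X^2=E\,\mathrm{tr}Y^2=1$ and $E\,\mathrm{tr}XY=0$ for the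
    normalized trace, $E\,\mathrm{tr}Z^*Z=a^2+b^2$ and
    $E\,\mathrm{tr}Z^2=e^2(a^2-b^2)$, which is $N$ times [param_cov]. *)
Lemma elliptic_param (s : R) (tau : R[i]) (Z : T -> 'M[R[i]]_N) : elliptic P s tau Z ->
  exists (f : T -> V) (m : probability V R) (p : param R),
   [/\ measurable_fun setT f, forall A, measurable A -> m A = pushforward P f A,
     product_law (fun k => normal_prob 0 (pair_sd R k)) m,
     forall w, Z w = ell_mx (fun=> p) (f w) &
     valid_param s p /\ N%:R * param_cov N p = s%:C - tau].
Proof.
move=> [theta [a [b [X [Y [[_ gX gY iXY] ZE sE tauE]]]]]].
pose e : R[i] := cos theta +i* sin theta.
pose f := gue_coords X Y.
have mf : measurable_fun setT f := measurable_gue_coords gX gY.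
pose fm : {mfun T >-> V} := HB.pack f (isMeasurableFun.Build _ _ _ _ _ mf).
pose m : probability V R := distribution P fm.
have m_law : product_law (fun k => normal_prob 0 (pair_sd R k)) m.
  by move=> B mB; exact: gue_coords_box.
have e1 : sqn e = 1 by rewrite /sqn /= cos2Dsin2.
exists f, m, (a, b, e).
pose q1 w := herm_inner (fun k => f w (inl k)) (fun k => f w (inl k)).
pose q2 w := herm_inner (fun k => f w (inr k)) (fun k => f w (inr k)).
pose q12 w := herm_inner (fun k => f w (inl k)) (fun k => f w (inr k)).
have M1 : has_mean P q1 N%:R.
  apply: (@has_mean_pushforward _ _ _ _ _ P m f _ _ mf _ (@measurable_herm_inner inl inl)) => //.
  exact: mean_herm_inner_same.
have M2 : has_mean P q2 N%:R.
  apply: (@has_mean_pushforward _ _ _ _ _ P m f _ _ mf _ (@measurable_herm_inner inr inr)) => //.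
  exact: mean_herm_inner_same.
have M12 : has_mean P q12 0.
  apply: (@has_mean_pushforward _ _ _ _ _ P m f _ _ mf _ (@measurable_herm_inner inl inr)) => //.
  exact: mean_herm_inner_cross.
have N0 : N%:R != 0 :> R by rewrite pnatr_eq0 -lt0n.
have NV : N%:R^-1 = (N%:R^-1)%:C :> R[i] by rewrite fmorphV /= rmorph_nat.
have E1 : cexpect P (fun w => ntr (adjmx (Z w) *m Z w)) = (a ^+ 2 + b ^+ 2)%:C.
  have h w : ntr (adjmx (Z w) *m Z w) = (N%:R^-1 * (a ^+ 2 * q1 w + b ^+ 2 * q2 w))%:C.
    by rewrite /ntr ZE -/e (elliptic_herm gX gY) tr_ell_adj// NV -rmorphM.
  rewrite /cexpect; congr (_ +i* _).
    rewrite (has_mean_expect (c := N%:R^-1 * (a ^+ 2 * N%:R + b ^+ 2 * N%:R))).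
      by field.
    apply: has_mean_eq (has_meanZ _ (has_meanD (has_meanZ _ M1) (has_meanZ _ M2))) _ erefl => w.
    by rewrite h.
  apply: has_mean_expect; apply: has_mean_eq (has_mean_cst P 0) _ erefl => w.
  by rewrite h.
have E2 : cexpect P (fun w => ntr (Z w *m Z w)) = e ^+ 2 * (a ^+ 2 - b ^+ 2)%:C.
  pose r := complex.Re (e ^+ 2); pose t := complex.Im (e ^+ 2).
  have eE : e ^+ 2 = r +i* t by rewrite /r /t; case: (e ^+ 2).
  pose A w := a ^+ 2 * q1 w + (- b ^+ 2) * q2 w.
  pose B w := 2 * (a * b) * q12 w.
  have MA : has_mean P A (a ^+ 2 * N%:R + (- b ^+ 2) * N%:R).
    by apply: has_meanD; exact: has_meanZ.
  have MB : has_mean P B (2 * (a * b) * 0) by exact: has_meanZ.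
  have h w : ntr (Z w *m Z w) = (N%:R^-1 * (r * A w + - t * B w)) +i*
     (N%:R^-1 * (r * B w + t * A w)).
    rewrite /ntr ZE -/e (elliptic_herm gX gY) tr_ell_sqr NV eE.
    apply/eqP; rewrite eq_complex /=; apply/andP; split; apply/eqP;
      rewrite /A /B /q1 /q2 /q12; ring.
  rewrite /cexpect eE; simpc; congr (_ +i* _).
    rewrite (has_mean_expect (c := N%:R^-1 *
      (r * (a ^+ 2 * N%:R + (- b ^+ 2) * N%:R) + - t * (2 * (a * b) * 0)))).
      by field.
    apply: has_mean_eq (has_meanZ _ (has_meanD (has_meanZ _ MA) (has_meanZ _ MB))) _ erefl => w.
    by rewrite h.
  rewrite (has_mean_expect (c := N%:R^-1 *
    (r * (2 * (a * b) * 0) + t * (a ^+ 2 * N%:R + (- b ^+ 2) * N%:R)))).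
    by field.
  apply: has_mean_eq (has_meanZ _ (has_meanD (has_meanZ _ MB) (has_meanZ _ MA))) _ erefl => w.
  by rewrite h.
have sab : s = a ^+ 2 + b ^+ 2 by move: sE; rewrite E1 => -[].
split => //.
- by move=> w; rewrite ZE -/e (elliptic_coords gX gY).
- split => //.
  rewrite tauE -sE E2 /param_cov /= opprB addrCA subrr addr0.
  by rewrite mulrA -NV mulfV ?mul1r// pnatr_eq0 -lt0n.
Qed.

End EllipticParameters.

(** * The heat identity *)

(** Measurability comes from the expression of the heat operator by differences of
    the determinant. *)
Lemma heat_char_poly_cmeas (R : realType) N (sigma z : R[i]) : (0 < N)%N ->
  @preserves_cmeas R N (fun M => (heat N sigma (char_poly M)).[z]).
Proof.
move=> N_gt0 d T M mM.
have := preserves_cmeas_prod_mixdiff (- (sigma / N%:R)) (upper_pairs N)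
  (@preserves_cmeas_det R N z) mM.
apply: cmeas_ext => w; rewrite prod_mixdiff_shifted_det horner_heat_char_poly.
apply: eq_bigr => k _; congr (_ * _ ^+ _ * _).
have N0 : N%:R != 0 :> R[i] by rewrite pnatr_eq0 -lt0n.
by field.
Qed.

Lemma random_ell_mx d (T : measurableType d) (R : realType) (N : nat)
    (g : T -> coord_space R ('I_N * 'I_N + 'I_N * 'I_N)%type) q (W : T -> 'M[R[i]]_N) :
  measurable_fun setT g -> (forall w, W w = ell_mx (fun=> q) (g w)) -> random_mx W.
Proof.
move=> mg WE; have -> : W = fun w => ell_mx (fun=> q) (g w) by exact/funext.
exact: (cmeas_mx_comp mg (@cmeas_ell_mx R N (fun=> q))).
Qed.

(** The case of a deterministic $X_0$: the Gaussian coordinates behind [Z] and [Z0]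
    are different functions on the sample space, but with the same law, so both
    sides are integrals over the same coordinate space. *)
Lemma integral_elliptic_heat d (T : measurableType d) (R : realType)
    (P : probability T R) (N : nat) (s : R) (tau0 tau : R[i]) (Z0 Z : T -> 'M[R[i]]_N)
    (A : 'M[R[i]]_N) (z : R[i]) :
  (0 < N)%N -> elliptic P s tau0 Z0 -> elliptic P s tau Z ->
  (\int[P]_w (sqn (\det (z%:M - (A + Z w))))%:E =
   \int[P]_w (sqn (heat N (tau - tau0) (char_poly (A + Z0 w))).[z])%:E)%E.
Proof.
move=> N_gt0 hZ0 hZ.
have [f [m [p [mf mE m_law ZE [vp pE]]]]] := elliptic_param N_gt0 hZ.
have [f0 [m0 [p0 [mf0 m0E m0_law Z0E [vp0 p0E]]]]] := elliptic_param N_gt0 hZ0.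
have -> : tau - tau0 = N%:R * (param_cov N p0 - param_cov N p).
  by rewrite mulrBr p0E pE; ring.
have same_law B : measurable B -> m B = m0 B.
  apply: measure_box_unique; first by rewrite [X in (X < _)%E]probability_setT ltry.
  by move=> C mC; exact: (etrans (m_law C mC) (esym (m0_law C mC))).
have [nl nr e] := param_cov_heat N_gt0 m_law A z vp vp0.
have el := nnmeas_integral_pushforward mf mE nl.
have er := nnmeas_integral_pushforward mf0 m0E nr.
transitivity (\int[P]_w (sqn (\det (z%:M - (A + ell_mx (fun=> p) (f w)))))%:E)%E.
  by apply: eq_integral => w _; rewrite ZE.
rewrite -el e (eq_measure_integral m0); last by move=> B mB _; exact: same_law.
by rewrite er; apply: eq_integral => w _; rewrite Z0E.
Qed.

Lemma elliptic_random_mx d (T : measurableType d) (R : realType)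
    (P : probability T R) (N : nat) (s : R) (tau : R[i]) (Z : T -> 'M[R[i]]_N) :
  (0 < N)%N -> elliptic P s tau Z -> random_mx Z.
Proof.
move=> N_gt0 /(elliptic_param N_gt0)[f [m [p [mf _ _ ZE _]]]].
exact: random_ell_mx mf ZE.
Qed.

Theorem theorem2p7 (d : measure_display) (T : measurableType d)
    (R : realType) (P : probability T R) (N : nat) (s : R) (tau0 tau : R[i])
    (Z0 Z X0 : T -> 'M[R[i]]_N)
    (hN : (1 <= N)%N) (hs : 0 < s)
    (htau0 : `|tau0 - s%:C| <= s%:C) (htau : `|tau - s%:C| <= s%:C)
    (hZ0 : elliptic P s tau0 Z0) (hZ : elliptic P s tau Z)
    (hX0 : random_mx X0) (hX0fin : finite_star_moments P X0)
    (hindep0 : indep_mx P X0 Z0) (hindep : indep_mx P X0 Z) :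
  forall z : R[i],
    'E_P[fun w => (Normc.normc (\det (z%:M - (X0 w + Z w))) ^+ 2)%R]%E =
    'E_P[fun w => (Normc.normc
           (heat N (tau - tau0) (char_poly (X0 w + Z0 w))).[z] ^+ 2)%R]%E.
Proof.
move=> z.
pose h (u : mx_space R N * mx_space R N) := (sqn (\det (z%:M - ((u.1 : 'M[R[i]]_N) + u.2))))%:E.
pose h0 (u : mx_space R N * mx_space R N) :=
  (sqn (heat N (tau - tau0) (char_poly ((u.1 : 'M[R[i]]_N) + u.2))).[z])%:E.
have mS : cmeas_mx (fun u : mx_space R N * mx_space R N => (u.1 : 'M[R[i]]_N) + u.2).
  by apply: cmeas_mxD; apply: (cmeas_mx_comp _ (@cmeas_mx_id R N));
    [exact: measurable_fst|exact: measurable_snd].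
have mh : measurable_fun setT h.
  by apply: measurable_sqn; exact: (@preserves_cmeas_det R N z _ _ _ mS).
have mh0 : measurable_fun setT h0.
  by apply: measurable_sqn; exact: (@heat_char_poly_cmeas R N (tau - tau0) z hN _ _ _ mS).
have h_ge0 u : (0 <= h u)%E by rewrite lee_fin sqn_ge0.
have h0_ge0 u : (0 <= h0 u)%E by rewrite lee_fin sqn_ge0.
have rZ := elliptic_random_mx hN hZ; have rZ0 := elliptic_random_mx hN hZ0.
transitivity (\int[P]_w h (X0 w, Z w))%E.
  by rewrite unlock; apply: eq_integral => w _; rewrite normc_sqr.
transitivity (\int[P]_w h0 (X0 w, Z0 w))%E; last first.
  by rewrite unlock; apply: eq_integral => w _; rewrite normc_sqr.
rewrite (integral_indep_mx hX0 rZ hindep mh h_ge0).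
rewrite (integral_indep_mx hX0 rZ0 hindep0 mh0 h0_ge0).
congr integral; apply/funext => A.
exact: (integral_elliptic_heat A z hN hZ0 hZ).
Qed.
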